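(* Let $M\rightarrow M'$ be an oriented matroid perspective on a (finite) linearly ordered set $E$, and let $p,q$ be non-negative integers. Then $$\frac{\partial^{p+q}t}{\partial x^p\,\partial y^q}(M,M';x,y,1)=p!\,q!\sum_{\substack{A\subseteq E\\ \overline{\theta}^*_{M'}(A)=p,\ \overline{\theta}_M(A)=q}}x^{\theta^*_{M'}(A)}\,y^{\theta_M(A)},$$ where $t(M,M';x,y,z)$ denotes the 3-variable Tutte polynomial of $M\rightarrow M'$.
   Context: Two oriented matroids $M,M'$ on the same finite set $E$ form an oriented matroid perspective, denoted $M\rightarrow M'$, if every signed circuit of $M$ is a conformal union of signed circuits of $M'$ (equivalently, every signed cocircuit of $M'$ is a conformal union of signed cocircuits of $M$). Here signed sets $Y\subseteq X$ are conformal if $Y^+\subseteq X^+$ and $Y^-\subseteq X^-$; a signed circuit $X$ is a conformal union of signed circuits $Y_i$ if $X^+=\bigcup_i Y_i^+$ and $X^-=\bigcup_i Y_i^-$. The Tutte polynomial of the perspective is $$t(M,M';x,y,z)=\sum_{A\subseteq E}(x-1)^{r(M')-r_{M'}(A)}(y-1)^{|A|-r_M(A)}z^{r(M)-r(M')-(r_M(A)-r_{M'}(A))},$$ where $r_N(A)$ is the rank of $A$ in the underlying matroid of $N$ and $r(N)=r_N(E)$. For an oriented matroid $N$ on a finite linearly ordered set $E$: a positive circuit (resp. cocircuit) is a signed circuit (resp. cocircuit) $X=(X^+,X^-)$ with $X^-=\emptyset$; $O(N)$ is the set of elements of $E$ that are the smallest element of some positive circuit of $N$; $O^*(N)=O(N^*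 )$ is the set of elements of $E$ that are the smallest element of some positive cocircuit of $N$. For $A\subseteq E$, $-_AN$ is the oriented matroid obtained from $N$ by reorientation on $A$ (the signs of the elements of $A$ are reversed in all signed circuits and cocircuits). The four $\theta$-activities are $$\theta_N(A)=|O(-_AN)\setminus A|,\quad \overline{\theta}_N(A)=|O(-_AN)\cap A|,$$ $$\theta^*_N(A)=|O^*(-_AN)\setminus A|,\quad \overline{\theta}^*_N(A)=|O^*(-_AN)\cap A|.$$ *)

(* Defs.v *)
From mathcomp Require Import all_boot all_order all_algebra.
From mathcomp.multinomials Require Import mpoly.

Set Implicit Arguments.
Unset Strict Implicit.
Unset Printing Implicit Defensive.

Import Order.TTheory GRing.Theory.

(* A signed subset of E is a pair X = (X^+, X^-); the disjointness of the two
   parts is carried by [is_signed]. *)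
Notation signed_set E := ({set E} * {set E})%type.

Section SignedSets.

Variable E : finType.
Implicit Types (X Y : signed_set E) (A : {set E}).

Definition is_signed X : bool := [disjoint X.1 & X.2].

Definition support X : {set E} := X.1 :|: X.2.

Definition opposite X : signed_set E := (X.2, X.1).

Definition reorient_set A X : signed_set E :=
  ((X.1 :\: A) :|: (X.2 :&: A), (X.2 :\: A) :|: (X.1 :&: A)).

(* X and Y are orthogonal if their signs agree somewhere on the intersection
   of their supports exactly when they disagree somewhere on it. *)
Definition orthogonal X Y : bool :=
  ((X.1 :&: Y.1) :|: (X.2 :&: Y.2) != set0)
    == ((X.1 :&: Y.2) :|: (X.2 :&: Y.1) != set0).

Lemma in_reorient1 A X e :
  (e \in (reorient_set A X).1) = (if e \in A then e \in X.2 else e \in X.1).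
Proof. by rewrite !inE; case: (e \in A); rewrite ?andbT ?andbF ?orbF. Qed.

Lemma in_reorient2 A X e :
  (e \in (reorient_set A X).2) = (if e \in A then e \in X.1 else e \in X.2).
Proof. by rewrite !inE; case: (e \in A); rewrite ?andbT ?andbF ?orbF. Qed.

Lemma reorient_setK A : involutive (reorient_set A).
Proof.
move=> X; rewrite [RHS]surjective_pairing [LHS]surjective_pairing.
by congr pair; apply/setP=> e;
  rewrite ?(in_reorient1, in_reorient2); case: (e \in A).
Qed.

Lemma reorient_opposite A X :
  reorient_set A (opposite X) = opposite (reorient_set A X).
Proof. by []. Qed.

Lemma support_reorient A X : support (reorient_set A X) = support X.
Proof.
apply/setP=> e; rewrite /support in_setU in_reorient1 in_reorient2 in_setU.
by case: (e \in A); rewrite // orbC.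
Qed.

Lemma is_signed_reorient A X : is_signed X -> is_signed (reorient_set A X).
Proof.
rewrite /is_signed -!setI_eq0 => /eqP/setP X0; apply/eqP/setP=> e.
by have := X0 e; rewrite !in_setI in_reorient1 in_reorient2;
  case: (e \in A); rewrite // andbC.
Qed.

End SignedSets.

Record oriented_matroid (E : finType) := OrientedMatroid {
  circuits : {set signed_set E};
  circuits_signed : forall X, X \in circuits -> is_signed X;
  circuits_neq0 : (set0, set0) \notin circuits;
  circuits_opposite : forall X, X \in circuits -> opposite X \in circuits;
  circuits_incomparable : forall X Y, X \in circuits -> Y \in circuits ->
    support X \subset support Y -> X = Y \/ X = opposite Y;
  circuits_elimination : forall X Y e, X \in circuits -> Y \in circuits ->
    X <> opposite Y -> e \in X.1 :&: Y.2 ->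
    exists2 Z, Z \in circuits &
      Z.1 \subset (X.1 :|: Y.1) :\ e /\ Z.2 \subset (X.2 :|: Y.2) :\ e
}.

Section Reorientation.

Variables (E : finType) (A : {set E}) (N : oriented_matroid E).

Definition reorient_circuits : {set signed_set E} :=
  [set reorient_set A X | X in circuits N].

Lemma mem_reorient_circuits X :
  (X \in reorient_circuits) = (reorient_set A X \in circuits N).
Proof.
by rewrite -{1}[X](reorient_setK A) mem_imset //; apply/inv_inj/reorient_setK.
Qed.

Lemma reorient_signed X : X \in reorient_circuits -> is_signed X.
Proof.
rewrite mem_reorient_circuits => /circuits_signed/(is_signed_reorient A).
by rewrite reorient_setK.
Qed.

Lemma reorient_neq0 : (set0, set0) \notin reorient_circuits.
Proof.
rewrite mem_reorient_circuits /reorient_set /= set0D set0I setU0.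
exact: circuits_neq0.
Qed.

Lemma reorient_opp X :
  X \in reorient_circuits -> opposite X \in reorient_circuits.
Proof.
by rewrite !mem_reorient_circuits reorient_opposite; apply: circuits_opposite.
Qed.

Lemma reorient_incomparable X Y :
  X \in reorient_circuits -> Y \in reorient_circuits ->
  support X \subset support Y -> X = Y \/ X = opposite Y.
Proof.
rewrite !mem_reorient_circuits -(support_reorient A X) -(support_reorient A Y).
move=> CX CY sXY; have [eXY|eXY] := circuits_incomparable CX CY sXY.
  by left; apply: (inv_inj (reorient_setK A)).
by right; apply: (inv_inj (reorient_setK A)).
Qed.

Lemma reorient_elimination X Y e :
  X \in reorient_circuits -> Y \in reorient_circuits ->
  X <> opposite Y -> e \in X.1 :&: Y.2 ->
  exists2 Z, Z \in reorient_circuits &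
    Z.1 \subset (X.1 :|: Y.1) :\ e /\ Z.2 \subset (X.2 :|: Y.2) :\ e.
Proof.
rewrite !mem_reorient_circuits => CX CY nXY /setIP[X1e Y2e].
set X' := reorient_set A X in CX *; set Y' := reorient_set A Y in CY *.
have nXY' : X' <> opposite Y'.
  by rewrite -reorient_opposite => /(inv_inj (reorient_setK A)).
have nYX' : Y' <> opposite X' by move=> h; apply: nXY'; rewrite h; case: (X').
have [Z CZ [sZ1 sZ2]] : exists2 Z, Z \in circuits N &
    Z.1 \subset (X'.1 :|: Y'.1) :\ e /\ Z.2 \subset (X'.2 :|: Y'.2) :\ e.
  have [eA|eA] := boolP (e \in A); last first.
    apply: circuits_elimination => //.
    by rewrite in_setI in_reorient1 in_reorient2 (negPf eA) X1e.
  rewrite setUC [X'.2 :|: _]setUC; apply: circuits_elimination => //.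
  by rewrite in_setI in_reorient1 in_reorient2 eA X1e Y2e.
exists (reorient_set A Z); first by rewrite mem_reorient_circuits reorient_setK.
have [X'1 X'2] := (in_reorient1 A X, in_reorient2 A X).
have [Y'1 Y'2] := (in_reorient1 A Y, in_reorient2 A Y).
rewrite -/X' -/Y' in X'1 X'2 Y'1 Y'2.
clearbody X' Y'.
split; apply/subsetP=> f; have := subsetP sZ2 f; have := subsetP sZ1 f;
  rewrite (in_reorient1, in_reorient2) !(in_setD1, in_setU) X'1 X'2 Y'1 Y'2;
  by case: (f \in A).
Qed.

Definition reorient : oriented_matroid E :=
  OrientedMatroid reorient_signed reorient_neq0 reorient_opp
    reorient_incomparable reorient_elimination.

End Reorientation.

Section UnderlyingMatroid.

Variables (E : finType) (N : oriented_matroid E).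

Definition independent (I : {set E}) : bool :=
  [forall X in circuits N, ~~ (support X \subset I)].

Definition basis (B : {set E}) : bool := maxset independent B.

Definition rank (A : {set E}) : nat :=
  \max_(I : {set E} | (I \subset A) && independent I) #|I|.

(* The cocircuits of the underlying matroid are the circuits of its dual, whose
   bases are the complements of the bases: D is dependent in the dual when it
   is contained in no complement of a basis, i.e. when it meets every basis. *)
Definition matroid_cocircuit (D : {set E}) : bool :=
  minset (fun D' : {set E} =>
    [forall B : {set E}, basis B ==> (D' :&: B != set0)]) D.

(* The circuits of the dual N^*: the unique signature of the cocircuits of the
   underlying matroid that is orthogonal to the signed circuits. *)
Definition cocircuits : {set signed_set E} :=
  [set Y : signed_set E | [&& is_signed Y, matroid_cocircuit (support Y)
    & [forall X in circuits N, orthogonal X Y]]].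

End UnderlyingMatroid.

Definition conformal_union (E : finType) (X : signed_set E)
    (F : {set signed_set E}) : bool :=
  (X.1 == \bigcup_(Y in F) Y.1) && (X.2 == \bigcup_(Y in F) Y.2).

Definition perspective (E : finType) (M M' : oriented_matroid E) : Prop :=
  forall X, X \in circuits M ->
    exists2 F : {set signed_set E}, F \subset circuits M' & conformal_union X F.

Section Activities.

Variables (d : Order.disp_t) (E : finOrderType d).
Implicit Types (C : {set signed_set E}) (N : oriented_matroid E).
Implicit Types (A : {set E}).

Definition min_positive C : {set E} :=
  [set e | [exists X in C,
    [&& X.2 == set0, e \in X.1 & [forall f in X.1, (e <= f)%O]]]].

Definition O_ N : {set E} := min_positive (circuits N).
Definition Ostar N : {set E} := min_positive (cocircuits N).

Definition theta N A : nat := #|O_ (reorient A N) :\: A|.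
Definition theta_bar N A : nat := #|O_ (reorient A N) :&: A|.
Definition theta_star N A : nat := #|Ostar (reorient A N) :\: A|.
Definition theta_star_bar N A : nat := #|Ostar (reorient A N) :&: A|.

End Activities.

(* The indices of the variables x, y, z. *)
Definition ix : 'I_3 := @Ordinal 3 0 isT.
Definition iy : 'I_3 := @Ordinal 3 1 isT.
Definition iz : 'I_3 := @Ordinal 3 2 isT.

Local Open Scope ring_scope.

(* The subtractions in the exponents are those of nat. For a perspective
   M -> M' every one of them is nonnegative, so none is truncated. *)
Definition tutte (R : comNzRingType) (E : finType) (M M' : oriented_matroid E) :
    {mpoly R[3]} :=
  \sum_(A : {set E})
    ('X_ix - 1) ^+ (rank M' setT - rank M' A)
    * ('X_iy - 1) ^+ (#|A| - rank M A)
    * 'X_iz ^+ ((rank M setT - rank M' setT) - (rank M A - rank M' A)).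

Definition point3 (R : comNzRingType) (x y z : R) : 'I_3 -> R :=
  tnth [tuple x; y; z].

(* Main.v *)
From mathcomp Require Import all_boot all_order all_algebra ring.
From mathcomp.multinomials Require Import mpoly.
Require Import Defs.

Set Implicit Arguments.
Unset Strict Implicit.
Unset Printing Implicit Defensive.

(** The exponent of z disappears at z = 1, so by Taylor expansion in x and y
    the theorem amounts to the following identity between elements x, u, y, v of
    an arbitrary commutative ring (lemma [orientation_expansion]): the sum over
    the subsets A of
      (x + u - 1) ^ (corank of A in M') * (y + v - 1) ^ (nullity of A in M)
    equals the sum over the subsets A of the monomials in x, u, y, v whose
    exponents are the four theta-activities of A.  In a polynomial ring with u
    and v as indeterminates, comparing the coefficients of u^p v^q gives the
    partial derivatives divided by p! q! on one side, and the sum restricted by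
    theta_star_bar = p and theta_bar = q on the other.

    The identity holds because both sides satisfy the same recursion when the
    largest element w is deleted or contracted.  Minors are not constructed:
    the minor obtained by contracting G and deleting R is represented by the
    two disjoint sets G and R, and its circuits are read off the circuits that
    avoid R, whose signs and order are inspected outside G only ([active]).
    Exchanging circuits with cocircuits, and G with R, dualizes every statement.

    Let A avoid w.  Write T1 and T2 for the sets of smallest elements of
    positive circuits for the reorientations on A and on A + w, and T0 and T3
    for those of the deletion and of the contraction of w.  Off w, one has
    T0 <= T1, T2 and T3 = T1 + T2 (union).  Moreover T1 = T0 or T2 = T0
    ([active_exclusive]): two positive circuits through w, one for each sign of
    w, could otherwise be combined into one that avoids w.  The cocircuits of
    M' give sets U0, U1, U2, U3 with the same properties.  Finally a positive
    circuit of M and a positive cocircuit of M' cannot share w, because in a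
    perspective they are orthogonal; hence T1 = T0 or U1 = U0, and T2 = T0 or
    U2 = U0 ([active_coherent]).  These constraints force the pairs (T1, U1) and
    (T2, U2) to be, in some order, the pairs attached to the deletion and to
    the contraction of w.  A loop of M contributes the factor y + v, a coloop
    of M' the factor x + u, as they do in the rank generating function.

    The oriented matroid theory behind this is the painting lemma ([painting]),
    which replaces strong elimination for circuits and for cocircuits at once.
    It reduces, by induction on the number of elements with a prescribed sign,
    to the existence of enough signed cocircuits ([cocircuit_exists]).  To sign
    the complement of a hyperplane H, contract H: the circuits of the
    contraction are pairs, whose signs determine the cocircuit up to a global
    sign, and orthogonality lifts back since every circuit is a conformal union
    of circuits of the contraction ([contract_circuit_refine]).  The latter is
    derived from weak elimination in [circuit_through_conformal]. *)

(** * Signs and elimination *)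

Section Sides.
Variable E : finType.
Implicit Types (X Y Z : signed_set E) (A : {set E}) (N : oriented_matroid E).

(** Indexing the two parts of a signed set by a boolean lets both signs be
    treated at once; [true] is the negative part, so that the sign that e must
    have in a circuit made positive by reorienting on A is [e \in A]. *)
Definition side X (b : bool) : {set E} := if b then X.2 else X.1.

Lemma supportP X e : reflect (exists b, e \in side X b) (e \in support X).
Proof.
rewrite in_setU; apply: (iffP orP) => [[]|[[]]]; [|by exists true|..].
- by exists false.
- by right.
- by left.
Qed.

Lemma side_support X b : side X b \subset support X.
Proof. by case: b; rewrite ?subsetUl ?subsetUr. Qed.

Lemma mem_side_support X b e : e \in side X b -> e \in support X.
Proof. exact/subsetP/side_support. Qed.

Lemma side_opposite X b : side (opposite X) b = side X (~~ b).
Proof. by case: b. Qed.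

Lemma support_opposite X : support (opposite X) = support X.
Proof. exact: setUC. Qed.

Lemma side_inj X b c e : is_signed X -> e \in side X b -> e \in side X c -> b = c.
Proof.
rewrite /is_signed => /pred0P/(_ e) /=.
by case: b c => [] [] //= + h1 h2; rewrite h1 h2.
Qed.

Lemma side_reorient A X b e :
  (e \in side (reorient_set A X) b) = (e \in side X (b (+) (e \in A))).
Proof.
by case: b => /=; rewrite ?in_reorient1 ?in_reorient2; case: (e \in A).
Qed.

Definition clash X Y : {set E} :=
  [set e | [exists b, (e \in side X b) && (e \in side Y (~~ b))]].

Lemma clashP X Y e :
  reflect (exists2 b, e \in side X b & e \in side Y (~~ b)) (e \in clash X Y).
Proof.
rewrite inE; apply: (iffP existsP) => [[b /andP[]]|[b h1 h2]]; exists b => //.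
by rewrite h1.
Qed.

Lemma orthogonal_clash X Y b e : orthogonal X Y ->
  e \in side X b -> e \in side Y b -> exists f, f \in clash X Y.
Proof.
move=> /eqP o h1 h2.
have : (X.1 :&: Y.1) :|: (X.2 :&: Y.2) != set0.
  apply/set0Pn; exists e; rewrite in_setU !in_setI.
  by case: b h1 h2 => /= -> -> //; rewrite orbT.
rewrite o => /set0Pn[f]; rewrite in_setU !in_setI => /orP[]/andP[X_f Y_f];
  exists f; apply/clashP; first [by exists false|by exists true].
Qed.

End Sides.

Section Circuits.
Variable (E : finType) (N : oriented_matroid E).
Implicit Types (X Y Z : signed_set E) (A : {set E}).

Local Notation C := (circuits N).

Lemma circuit_side X b c e : X \in C -> e \in side X b -> e \in side X c -> b = c.
Proof. by move/circuits_signed; apply: side_inj. Qed.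

Lemma circuit_support_neq0 X : X \in C -> support X != set0.
Proof.
move=> CX; apply: contraTneq CX; rewrite /support => /eqP.
rewrite setU_eq0 => /andP[/eqP X1 /eqP X2].
by rewrite [X]surjective_pairing X1 X2 circuits_neq0.
Qed.

Lemma circuit_support_eq X Y : X \in C -> Y \in C ->
  support X \subset support Y -> support X = support Y.
Proof.
by move=> CX CY /(circuits_incomparable CX CY)[]->; rewrite ?support_opposite.
Qed.

Lemma eliminate X Y b e : X \in C -> Y \in C -> X <> opposite Y ->
  e \in side X b -> e \in side Y (~~ b) ->
  exists2 Z, Z \in C & forall c, side Z c \subset (side X c :|: side Y c) :\ e.
Proof.
move=> CX CY nXY Xe Ye; case: b Xe Ye => /= Xe Ye.
  have nYX : Y <> opposite X by move=> h; apply: nXY; rewrite h; case: (X).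
  have Ye' : e \in Y.1 :&: X.2 by rewrite in_setI Ye.
  have [Z CZ [Z1 Z2]] := circuits_elimination CY CX nYX Ye'.
  by exists Z => // -[]; rewrite setUC.
have Xe' : e \in X.1 :&: Y.2 by rewrite in_setI Xe.
have [Z CZ [Z1 Z2]] := circuits_elimination CX CY nXY Xe'.
by exists Z => // -[].
Qed.

(** After replacing Y by its opposite if necessary, any common element of the
    supports carries opposite signs. *)
Lemma eliminate_support X Y e : X \in C -> Y \in C -> support X != support Y ->
  e \in support X -> e \in support Y ->
  exists2 Z, Z \in C & support Z \subset (support X :|: support Y) :\ e.
Proof.
move=> CX CY nXY /supportP[b Xe] /supportP[c Ye].
have {nXY} nXY Y' : support Y' = support Y -> X <> opposite Y'.
  by move=> eY h; move/eqP: nXY; apply; rewrite h support_opposite.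
suff [Y' [CY' sY' Ye']] : exists Y', [/\ Y' \in C, support Y' = support Y
    & e \in side Y' (~~ b)].
  have [Z CZ sZ] := eliminate CX CY' (nXY _ sY') Xe Ye'.
  exists Z => //; apply/subsetP => f /supportP[d /(subsetP (sZ d))].
  case/setD1P=> fe /setUP fXY; apply/setD1P; split=> //; apply/setUP.
  by case: fXY => /mem_side_support; [left|right; rewrite -sY'].
have [cb|cb] := eqVneq c (~~ b); first by exists Y; rewrite -cb.
exists (opposite Y); split; rewrite ?support_opposite ?circuits_opposite //.
by rewrite side_opposite; case: (b) (c) cb Ye => [] [].
Qed.

(** Two successive eliminations replace strong elimination here: if Z and the
    circuit W obtained from X and Z both miss f, eliminating h between them
    produces a circuit strictly inside X. *)
Lemma circuit_through X h f Z : X \in C -> h \notin support X ->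
  f \in support X -> Z \in C -> h \in support Z ->
  support Z \subset h |: support X -> support Z != [set h] ->
  exists Z', [/\ Z' \in C, h \in support Z', f \in support Z'
    & support Z' \subset h |: support X].
Proof.
move=> CX hX fX CZ hZ sZ nZ.
have [fZ|fZ] := boolP (f \in support Z); first by exists Z.
have [g gZ gh] : exists2 g, g \in support Z & g != h.
  have : support Z :\ h != set0.
    by apply: contraNneq nZ => /eqP; rewrite setD_eq0 subset1 => /orP[//|/eqP Z0];
       rewrite Z0 inE in hZ.
  by case/set0Pn=> g /setD1P[]; exists g.
have gX : g \in support X.
  by have := subsetP sZ g gZ; rewrite in_setU1 (negPf gh).
have neXZ : support X != support Z by apply: contraNneq hX => ->.
have [W CW sW] := eliminate_support CX CZ neXZ gX gZ.
have sWX : support W \subset h |: support X.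
  apply: (subset_trans sW); apply/subsetP => k; rewrite in_setD1 in_setU.
  by case/andP=> _ /orP[kX|/(subsetP sZ)//]; rewrite in_setU1 kX orbT.
have gW : g \notin support W.
  by apply/negP => /(subsetP sW); rewrite in_setD1 eqxx.
have hW : h \in support W.
  apply: contraT => hW; have : support W \subset support X.
    apply/subsetP => k kW; have := subsetP sWX k kW; rewrite in_setU1.
    by case/orP => // /eqP kh; rewrite -kh kW in hW.
  by move/(circuit_support_eq CW CX) => e; rewrite e gX in gW.
have [fW|fW] := boolP (f \in support W); first by exists W.
have neZW : support Z != support W by apply: contraNneq gW => <-.
have [V CV sV] := eliminate_support CZ CW neZW hZ hW.
have sVX : support V \subset support X.
  apply/subsetP => k /(subsetP sV); rewrite in_setD1 in_setU => /andP[kh].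
  by case/orP => [/(subsetP sZ)|/(subsetP sWX)]; rewrite in_setU1 (negPf kh).
have fV : f \in support V by rewrite (circuit_support_eq CV CX sVX).
have := subsetP sV f fV; rewrite in_setD1 in_setU => /andP[_].
by rewrite (negPf fZ) (negPf fW).
Qed.

(** This is what makes contraction of h well behaved: outside h, the circuit X
    is covered by circuits through h that conform to it.  Among the circuits
    through h and f that have the sign of X at f, take one with the fewest
    clashes with X.  Eliminating a clash g between X and Z keeps h and creates
    no clash.  It also keeps f: otherwise the resulting W misses both f and g,
    and eliminating h between Z and the opposite of W gives a circuit supported
    by X that agrees with X at f but not at g. *)
Lemma circuit_through_conformal X h f Z0 : X \in C -> h \notin support X ->
  f \in support X -> Z0 \in C -> h \in support Z0 ->
  support Z0 \subset h |: support X -> support Z0 != [set h] ->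
  exists Z', [/\ Z' \in C, h \in support Z', f \in support Z'
    & forall c, side Z' c :\ h \subset side X c].
Proof.
move=> CX hX fX CZ0 hZ0 sZ0 nZ0; have [b fXb] := supportP _ _ fX.
have [Z [CZ hZ sZ fZb]] : exists Z, [/\ Z \in C, h \in support Z,
    support Z \subset h |: support X & f \in side Z b].
  have [Z [CZ hZ fZ sZ]] := circuit_through CX hX fX CZ0 hZ0 sZ0 nZ0.
  have [c fZc] := supportP _ _ fZ.
  have [bc|bc] := eqVneq b c; first by exists Z; rewrite bc.
  exists (opposite Z); rewrite support_opposite circuits_opposite //.
  by rewrite side_opposite; split=> //; case: (b) (c) bc fZc => [] [].
clear Z0 CZ0 hZ0 sZ0 nZ0; have [n] := ubnP #|clash X Z|.
elim: n Z CZ hZ sZ fZb => [|n IHn Z CZ hZ sZ fZb ltn]; first by [].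
have [cl0|] := eqVneq (clash X Z) set0.
  exists Z; split=> // [|c]; first exact: mem_side_support fZb.
  apply/subsetP => k /setD1P[kh kZ].
  have := subsetP sZ k (mem_side_support kZ); rewrite in_setU1 (negPf kh) /=.
  case/supportP=> d kX; have [<-//|cd] := eqVneq d c.
  have : k \in clash X Z.
    by apply/clashP; exists d => //; case: (d) (c) cd kZ => [] [].
  by rewrite cl0 inE.
case/set0Pn=> g gcl; have [d gX gZ] := clashP _ _ _ gcl.
have nXZ : X <> opposite Z by move=> e; rewrite e support_opposite hZ in hX.
have [W CW sW] := eliminate CX CZ nXZ gX gZ.
have sWX : support W \subset h |: support X.
  apply/subsetP => k /supportP[c /(subsetP (sW c))]; rewrite in_setD1 in_setU.
  case/andP=> _ /orP[]/mem_side_support; last exact: (subsetP sZ).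
  by rewrite in_setU1 => ->; rewrite orbT.
have gW : g \notin support W.
  by apply/supportP => -[c /(subsetP (sW c))]; rewrite in_setD1 eqxx.
have hW : h \in support W.
  apply: contraT => hW; have : support W \subset support X.
    apply/subsetP => k kW; have := subsetP sWX k kW; rewrite in_setU1.
    by case/orP => // /eqP kh; rewrite -kh kW in hW.
  move/(circuit_support_eq CW CX) => e.
  by rewrite e (mem_side_support gX) in gW.
have [c hWc] := supportP _ _ hW.
have hZc : h \in side Z c.
  have := subsetP (sW c) h hWc; rewrite in_setD1 in_setU => /andP[_ /orP[]//].
  by move/mem_side_support; rewrite (negPf hX).
have [/supportP[c' fW]|fW] := boolP (f \in support W).
  have ec' : c' = b.
    have := subsetP (sW c') f fW; rewrite in_setD1 in_setU => /andP[_ /orP[]] h';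
    [exact: circuit_side CX h' fXb|exact: circuit_side CZ h' fZb].
  apply: (IHn W) => //; first by rewrite -ec'.
  apply: leq_trans (ltn : #|clash X Z| <= n); apply: proper_card.
  apply/properP; split; last first.
    exists g => //; apply/clashP => -[a _ /mem_side_support].
    by rewrite (negPf gW).
  apply/subsetP => k /clashP[a kX kW]; apply/clashP; exists a => //.
  have := subsetP (sW (~~ a)) k kW; rewrite in_setD1 in_setU => /andP[_ /orP[]//].
  by move/(circuit_side CX kX); case: (a).
(* Here W misses f and g; both Z and W have sign c at h. *)
have nZW : Z <> opposite (opposite W).
  move=> e; rewrite e !support_opposite in hZ *.
  by move: gZ gW; rewrite e => /mem_side_support; rewrite !support_opposite => ->.
have [|V CV sV] := eliminate CZ (circuits_opposite CW) nZW hZc.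
  by rewrite side_opposite negbK.
have sVX : support V \subset support X.
  apply/subsetP => k /supportP[a /(subsetP (sV a))].
  rewrite in_setD1 in_setU side_opposite => /andP[kh].
  case/orP=> /mem_side_support; [move/(subsetP sZ)|move/(subsetP sWX)];
  by rewrite in_setU1 (negPf kh).
have eVX := circuit_support_eq CV CX sVX.
have fV : f \in side V b.
  have /supportP[a fVa] : f \in support V by rewrite eVX.
  have := subsetP (sV a) f fVa; rewrite in_setD1 in_setU side_opposite.
  case/andP=> _ /orP[fZ|/mem_side_support]; last by rewrite (negPf fW).
  by rewrite (circuit_side CZ fZb fZ).
have gV : g \in side V (~~ d).
  have /supportP[a gVa] : g \in support V by rewrite eVX (mem_side_support gX).
  have := subsetP (sV a) g gVa; rewrite in_setD1 in_setU side_opposite.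
  case/andP=> _ /orP[gZ'|/mem_side_support]; last by rewrite (negPf gW).
  by rewrite (circuit_side CZ gZ gZ').
have [e|e] := circuits_incomparable CV CX sVX; move: fV gV; rewrite e.
  by move=> _ /(circuit_side CX gX); case: (d).
by rewrite side_opposite => /(circuit_side CX fXb); case: (b).
Qed.

End Circuits.

(** * Contraction *)

Section Contraction.
Variable E : finType.
Implicit Types (X Y Z : signed_set E) (A H : {set E}) (N : oriented_matroid E).

Definition drop (H : {set E}) X : signed_set E := (X.1 :\: H, X.2 :\: H).

Lemma side_drop H X b : side (drop H X) b = side X b :\: H.
Proof. by case: b. Qed.

Lemma support_drop H X : support (drop H X) = support X :\: H.
Proof. by rewrite /support /= -setDUl. Qed.

Section Single.
Variables (N : oriented_matroid E) (h : E).
Local Notation C := (circuits N).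

(** The traces are minimized among those with a nonempty support; when h is a
    loop, this leaves the circuits that avoid h. *)
Definition contract_circuits : {set signed_set E} :=
  [set Z in [set drop [set h] X | X in C] | (support Z != set0) &&
    [forall X in C, (support X :\ h != set0) ==>
       (support X :\ h \subset support Z) ==> (support Z \subset support X :\ h)]].

Lemma mem_contract Z : reflect
  [/\ exists2 X, X \in C & Z = drop [set h] X, support Z != set0 &
     forall X, X \in C -> support X :\ h != set0 ->
       support X :\ h \subset support Z -> support Z \subset support X :\ h]
  (Z \in contract_circuits).
Proof.
rewrite inE; apply: (iffP and3P) => -[h1 h2 h3]; split => //.
- by have /imsetP := h1.
- move=> X CX X0 sXZ; have /forall_inP/(_ X CX) := h3.
  by move/implyP/(_ X0)/implyP; apply.
- exact/imsetP.
- by apply/forall_inP => X CX; apply/implyP => X0; apply/implyP; apply: h3.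
Qed.

Lemma contract_of_mem X f : X \in C -> h \in support X -> f \in support X ->
  f != h -> drop [set h] X \in contract_circuits.
Proof.
move=> CX hX fX fh; apply/mem_contract; rewrite support_drop; split.
- by exists X.
- by apply/set0Pn; exists f; apply/setD1P.
- move=> Y CY Y0 sYX; rewrite (circuit_support_eq CY CX) //.
  apply/subsetP => k kY; have [->//|kh] := eqVneq k h.
  by have /(subsetP sYX)/setD1P[] : k \in support Y :\ h by apply/setD1P.
Qed.

(** Every circuit is, outside h, a conformal union of circuits of the
    contraction.  If its trace is not minimal, some circuit through h lies in
    h |: support X, and [circuit_through_conformal] applies. *)
Lemma contract_refine X f : X \in C -> f \in support X -> f != h ->
  exists Z, [/\ Z \in contract_circuits, f \in support Z
    & forall c, side Z c \subset side X c].
Proof.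
move=> CX fX fh; have [hX|hX] := boolP (h \in support X).
  exists (drop [set h] X); split; first exact: contract_of_mem fh.
    by rewrite support_drop; apply/setD1P.
  by move=> c; rewrite side_drop subsetDl.
have eX : support X :\ h = support X.
  by apply/setDidPl; rewrite disjoint_sym disjoints1.
have [cX|] := boolP (drop [set h] X \in contract_circuits).
  exists (drop [set h] X); split=> //; first by rewrite support_drop eX.
  by move=> c; rewrite side_drop subsetDl.
have [/existsP[Y /and4P[CY Y0 sYX nXY]] _|no] := boolP [exists Y, [&& Y \in C,
  support Y :\ h != set0, support Y :\ h \subset support X &
  ~~ (support X \subset support Y :\ h)]].
  have hY : h \in support Y.
    apply: contraNT nXY => hY.
    have eY : support Y :\ h = support Y by apply/setDidPl; rewrite disjoint_sym disjoints1.
    by rewrite eY in sYX *; rewrite (circuit_support_eq CY CX).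
  have sYX' : support Y \subset h |: support X by rewrite -subDset.
  have nY : support Y != [set h].
    by apply: contraNneq Y0 => ->; rewrite setDv.
  have [Z [CZ hZ fZ sZ]] := circuit_through_conformal CX hX fX CY hY sYX' nY.
  exists (drop [set h] Z); split; first exact: contract_of_mem fh.
    by rewrite support_drop; apply/setD1P.
  by move=> c; rewrite side_drop.
case/negP; apply/mem_contract; rewrite support_drop eX; split.
- by exists X.
- exact: circuit_support_neq0 CX.
- move=> Y CY Y0 sYX; apply: contraNT no => nXY.
  by apply/existsP; exists Y; rewrite CY Y0 sYX.
Qed.

Lemma contract_lift Z : Z \in contract_circuits ->
  exists2 X, X \in C & Z = drop [set h] X.
Proof. by case/mem_contract. Qed.

Lemma contract_signed Z : Z \in contract_circuits -> is_signed Z.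
Proof.
case/contract_lift => X /circuits_signed sX ->.
by apply: disjointWl (subsetDl _ _) (disjointWr (subsetDl _ _) sX).
Qed.

Lemma contract_neq0 : (set0, set0) \notin contract_circuits.
Proof. by apply/mem_contract => -[_]; rewrite /support /= setU0 eqxx. Qed.

Lemma contract_opposite Z :
  Z \in contract_circuits -> opposite Z \in contract_circuits.
Proof.
case/mem_contract => -[X CX eZ] Z0 minZ; apply/mem_contract.
rewrite support_opposite; split => //.
by exists (opposite X); rewrite ?circuits_opposite // eZ.
Qed.

Lemma contract_support_eq Z Z' : Z \in contract_circuits ->
  Z' \in contract_circuits -> support Z \subset support Z' ->
  support Z = support Z'.
Proof.
case/mem_contract => -[X CX ->] Z0 _ /mem_contract[_ _ min'] s.
rewrite support_drop in Z0 s *; apply/eqP; rewrite eqEsubset s /=.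
exact: min'.
Qed.

Lemma contract_incomparable Z Z' : Z \in contract_circuits ->
  Z' \in contract_circuits -> support Z \subset support Z' ->
  Z = Z' \/ Z = opposite Z'.
Proof.
move=> cZ cZ' s; have := contract_support_eq cZ cZ' s.
have [X CX ->] := contract_lift cZ; have [X' CX' ->] := contract_lift cZ'.
rewrite !support_drop => e.
have sub Y Y' : support Y :\ h = support Y' :\ h -> h \notin support Y ->
    support Y \subset support Y'.
  move=> eY hY; rewrite -(setDidPl (_ : [disjoint support Y & [set h]])).
    by rewrite eY subsetDl.
  by rewrite disjoint_sym disjoints1.
have [h1|h1] := boolP (h \in support X); last first.
  by case: (circuits_incomparable CX CX' (sub _ _ e h1)) => ->; [left|right].
have [h2|h2] := boolP (h \in support X'); last first.
  case: (circuits_incomparable CX' CX (sub _ _ (esym e) h2)) => ->; first by left.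
  by right; case: X {CX e h1}.
have s' : support X \subset support X'.
  by rewrite -(setD1K h1) -(setD1K h2) e.
by case: (circuits_incomparable CX CX' s') => ->; [left|right].
Qed.

(** Weak elimination is performed before contracting; the trace of the result
    need not be minimal, but it contains a conformal circuit of the
    contraction. *)
Lemma contract_elimination Z Z' e : Z \in contract_circuits ->
  Z' \in contract_circuits -> Z <> opposite Z' -> e \in Z.1 :&: Z'.2 ->
  exists2 W, W \in contract_circuits &
    W.1 \subset (Z.1 :|: Z'.1) :\ e /\ W.2 \subset (Z.2 :|: Z'.2) :\ e.
Proof.
(* No circuit whose trace is a circuit of the contraction contains a loop h. *)
move=> cZ cZ' nZ; have nloop Y : drop [set h] Y \in contract_circuits ->
    Y \in C -> [set h] \in [set support X | X in C] -> h \notin support Y.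
  move=> /mem_contract[_ + _] CY /imsetP[L CL eL]; rewrite support_drop.
  apply: contraNN => hY; rewrite setD_eq0 -(circuit_support_eq CL CY) -eL //.
  by rewrite sub1set.
move: cZ cZ' nZ.
move=> + + + /setIP[]; move=> cZ cZ'.
have [X CX eZ] := contract_lift cZ; have [X' CX' eZ'] := contract_lift cZ'.
rewrite eZ eZ' in cZ cZ' *; move=> nZ /setD1P[_ eX] /setD1P[eh eX'].
have nX : X <> opposite X' by move=> eq; apply: nZ; rewrite eq.
have [W CW sW] := @eliminate _ N X X' false e CX CX' nX eX eX'.
have [f fW fh] : exists2 f, f \in support W & f != h.
  have [h0|/set0Pn[f /setD1P[fh fW]]] := eqVneq (support W :\ h) set0; last by exists f.
  have eW : [set h] = support W.
    apply/eqP; rewrite eq_sym eqEsubset -setD_eq0 h0 eqxx sub1set.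
    have /set0Pn[k kW] := circuit_support_neq0 CW.
    have [<-//|kh] := eqVneq k h.
    by have : k \in support W :\ h by [apply/setD1P]; rewrite h0 inE.
  have [c hW] : exists c, h \in side W c by apply/supportP; rewrite -eW set11.
  have CWh : [set h] \in [set support Y | Y in C] by rewrite eW; apply: imset_f.
  have := subsetP (sW c) h hW; rewrite in_setD1 => /andP[_ /setUP[]];
    by move/mem_side_support; rewrite (negPf (nloop _ _ _ CWh)).
have [V [cV _ sV]] := contract_refine CW fW fh.
have sVs c : side V c \subset (side (drop [set h] X) c :|: side (drop [set h] X') c) :\ e.
  rewrite !side_drop; apply/subsetP => k kV.
  have := subsetP (sW c) k (subsetP (sV c) k kV).
  have kh : k != h.
    have [Y _ eV] := contract_lift cV.
    by move: kV; rewrite eV side_drop => /setD1P[].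
  by rewrite !inE kh.
by exists V => //; split; [apply: (sVs false)|apply: (sVs true)].
Qed.

Definition contract1 : oriented_matroid E :=
  OrientedMatroid contract_signed contract_neq0 contract_opposite
    contract_incomparable contract_elimination.
End Single.

(** The ground set is kept: the elements of H belong to no circuit of the
    contraction, so that the order in which they are contracted is immaterial
    for the proofs. *)
Definition contract N (H : {set E}) : oriented_matroid E :=
  foldr (fun h N' => contract1 N' h) N (enum H).

Lemma contract_circuit_lift N H Z : Z \in circuits (contract N H) ->
  exists2 X, X \in circuits N & Z = drop H X.
Proof.
rewrite -{2}(set_enum H) /contract; elim: (enum H) Z => [|h s IHs] Z /=.
  by move=> CZ; exists Z => //; rewrite /drop set_nil !setD0; case: (Z).
case/contract_lift => Y /IHs[X CX ->] ->; exists X => //.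
by rewrite /drop set_cons /= !setDDl ![_ :|: [set h]]setUC.
Qed.

Lemma contract_circuit_refine N H X f : X \in circuits N -> f \in support X ->
  f \notin H -> exists Z, [/\ Z \in circuits (contract N H), f \in support Z
    & forall c, side Z c \subset side X c].
Proof.
rewrite -(mem_enum H) /contract; elim: (enum H) => [|h s IHs] CX fX /=.
  by exists X.
rewrite inE negb_or => /andP[fh fs]; have [Y [CY fY sY]] := IHs CX fX fs.
have [Z [CZ fZ sZ]] := contract_refine CY fY fh.
by exists Z; split => // c; apply: subset_trans (sZ c) (sY c).
Qed.

Lemma contract_circuit_disjoint N H Z e : Z \in circuits (contract N H) ->
  e \in support Z -> e \notin H.
Proof. by case/contract_circuit_lift => X _ ->; rewrite support_drop => /setDP[]. Qed.

Lemma side_sub_support X Y :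
  (forall c, side X c \subset side Y c) -> support X \subset support Y.
Proof. by move=> s; apply: setUSS; [apply: (s false)|apply: (s true)]. Qed.

End Contraction.

(** * Closure and the existence of cocircuits *)

Section Closure.
Variables (E : finType) (N : oriented_matroid E).
Implicit Types (X Y Z : signed_set E) (A B G H I S : {set E}).
Local Notation C := (circuits N).

Definition spanned S e : bool :=
  [exists X in C, (e \in support X) && (support X \subset e |: S)].

Lemma spannedP S e : reflect
  (exists X, [/\ X \in C, e \in support X & support X \subset e |: S])
  (spanned S e).
Proof.
apply: (iffP exists_inP) => [[X CX /andP[]]|[X [CX h1 h2]]]; exists X => //.
by rewrite h1.
Qed.

Lemma spannedS S S' e : S \subset S' -> spanned S e -> spanned S' e.
Proof.
move=> sS /spannedP[X [CX eX sX]]; apply/spannedP; exists X; split=> //.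
exact: subset_trans sX (setUS _ sS).
Qed.

Lemma spanned_contract S e : e \notin S -> reflect
  (exists2 Z, Z \in circuits (contract N S) & support Z = [set e]) (spanned S e).
Proof.
move=> eS; apply: (iffP (spannedP _ _)) => [[X [CX eX sX]]|[Z CZ eZ]].
  have [Z [CZ eZ sZ]] := contract_circuit_refine CX eX eS; exists Z => //.
  apply/eqP; rewrite eqEsubset sub1set eZ andbT.
  apply/subsetP => f fZ; have fS := contract_circuit_disjoint CZ fZ.
  have := subsetP sX f (subsetP (side_sub_support sZ) f fZ).
  by rewrite !inE (negPf fS) orbF.
have [X CX dX] := contract_circuit_lift CZ.
rewrite dX support_drop in eZ; exists X; split=> //.
  by have /setDP[] : e \in support X :\: S by rewrite eZ set11.
by rewrite setUC -subDset eZ.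
Qed.

(** Contracting B turns every s in S into a loop, and a circuit of the
    contraction through e cannot properly contain a loop. *)
Lemma spanned_trans S B e : (forall s, s \in S -> s \notin B -> spanned B s) ->
  e \notin B -> spanned S e -> spanned B e.
Proof.
move=> spB eB /spannedP[X [CX eX sX]].
have [Z [CZ eZ sZ]] := contract_circuit_refine CX eX eB.
apply/(spanned_contract eB); exists Z => //.
apply/eqP; rewrite eqEsubset sub1set eZ andbT; apply/subsetP => f fZ.
rewrite inE; apply: contraT => fe.
have fB := contract_circuit_disjoint CZ fZ.
have := subsetP sX f (subsetP (side_sub_support sZ) f fZ).
rewrite in_setU1 (negPf fe) /= => /spB/(_ fB)/(spanned_contract fB)[W CW eW].
have := circuit_support_eq CW CZ; rewrite eW sub1set => /(_ fZ) eWZ.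
by move: eZ; rewrite -eWZ inE eq_sym (negPf fe).
Qed.

Lemma independentP I :
  reflect (forall X, X \in C -> ~~ (support X \subset I)) (independent N I).
Proof. exact: forall_inP. Qed.

Lemma independentU1 I e : independent N I -> e \notin I ->
  independent N (e |: I) = ~~ spanned I e.
Proof.
move=> /independentP iI eI; apply/independentP/idP => [iIe|nsp X CX].
  by apply/spannedP => -[X [CX _ sX]]; move: (iIe X CX); rewrite sX.
apply: contra (nsp) => sX; apply/spannedP; exists X; split=> //.
apply: contraT => eX; case/negP: (iI X CX); rewrite -(setU1K eI).
by rewrite subsetD1 sX.
Qed.

End Closure.

Arguments spannedP {E N S e}.
Arguments spanned_contract {E N S e}.
Arguments independentP {E N I}.

Section Cocircuit.
Variables (E : finType) (N : oriented_matroid E).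
Implicit Types (X Y Z : signed_set E) (A B G H I S : {set E}).
Local Notation C := (circuits N).

Lemma cocircuit_orthogonal X Y : X \in C -> Y \in cocircuits N -> orthogonal X Y.
Proof. by move=> CX; rewrite inE => /and3P[_ _ /forall_inP]; apply. Qed.

Lemma cocircuit_signed Y : Y \in cocircuits N -> is_signed Y.
Proof. by rewrite inE => /and3P[]. Qed.

(** H is a hyperplane avoiding e, given as a maximal set that does not span e. *)
Variables (e : E) (H : {set E}).
Hypotheses (eH : e \notin H) (neH : ~~ spanned N H e).
Hypothesis maxH : forall f, f \notin H -> f != e -> spanned N (f |: H) e.

Local Notation K := (circuits (contract N H)).

Lemma hyper_notin Z f : Z \in K -> f \in support Z -> f \notin H.
Proof. exact: contract_circuit_disjoint. Qed.

Lemma hyper_pair_e f : f \notin H -> f != e ->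
  exists2 Z, Z \in K & support Z = [set e; f].
Proof.
move=> fH fe; have /spannedP[X [CX eX sX]] := maxH fH fe.
have [Z [CZ eZ sZ]] := contract_circuit_refine CX eX eH; exists Z => //.
have sZef : support Z \subset [set e; f].
  apply/subsetP => k kZ; have kH := hyper_notin CZ kZ.
  have := subsetP sX k (subsetP (side_sub_support sZ) k kZ).
  by rewrite !inE (negPf kH) orbF.
have [fZ|fZ] := boolP (f \in support Z).
  by apply/eqP; rewrite eqEsubset sZef subUset !sub1set eZ.
case/negP: neH; apply/(spanned_contract eH); exists Z => //.
apply/eqP; rewrite eqEsubset sub1set eZ andbT; apply/subsetP => k kZ.
have := subsetP sZef k kZ; rewrite !inE => /orP[//|/eqP kf].
by rewrite kf (negPf fZ) in kZ.
Qed.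

Lemma hyper_single Z f : Z \in K -> support Z <> [set f].
Proof.
move=> CZ eZ; have fZ : f \in support Z by rewrite eZ set11.
have fH := hyper_notin CZ fZ; have [fe|fe] := eqVneq f e.
  case/negP: neH; apply/(spanned_contract eH).
  by exists Z; rewrite // eZ fe.
have [W CW eW] := hyper_pair_e fH fe.
have := circuit_support_eq CZ CW; rewrite eZ eW sub1set !inE eqxx orbT.
by move/(_ isT)/setP/(_ e); rewrite !inE eqxx eq_sym (negPf fe).
Qed.

Lemma subset_pair (A : {set E}) f g : A \subset [set f; g] -> A != set0 ->
  A <> [set f] -> A <> [set g] -> A = [set f; g].
Proof.
move=> sA /set0Pn[k kA] nf ng; apply/eqP; rewrite eqEsubset sA subUset !sub1set /=.
apply/andP; split; apply: contraT => h.
- case: ng; apply/eqP; rewrite eqEsubset sub1set.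
  have sAg : A \subset [set g].
    apply/subsetP => l lA; have := subsetP sA l lA; rewrite !inE.
    by case/orP=> // /eqP le; rewrite -le lA in h.
  by rewrite sAg; have := subsetP sAg k kA; rewrite inE => /eqP <-.
- case: nf; apply/eqP; rewrite eqEsubset sub1set.
  have sAf : A \subset [set f].
    apply/subsetP => l lA; have := subsetP sA l lA; rewrite !inE.
    by case/orP=> // /eqP le; rewrite -le lA in h.
  by rewrite sAf; have := subsetP sAf k kA; rewrite inE => /eqP <-.
Qed.

(** The element e gets the positive sign; orthogonality to the pairs {e, f} then
    determines the sign of f. *)
Definition hyper_sign f : bool :=
  (f != e) && [exists Z in K, (e \in Z.1) && (f \in Z.1)].

Definition hyper_cocircuit : signed_set E :=
  ([set f in ~: H | ~~ hyper_sign f], [set f in ~: H | hyper_sign f]).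

Lemma side_hyper f b :
  (f \in side hyper_cocircuit b) = (f \notin H) && (hyper_sign f == b).
Proof. by case: b; rewrite /= !inE; case: (hyper_sign f). Qed.

Lemma support_hyper : support hyper_cocircuit = ~: H.
Proof. by apply/setP => f; rewrite !inE; case: (f \in H); case: (hyper_sign f). Qed.

Lemma hyper_e Z f : Z \in K -> e \in support Z -> f \in support Z -> f != e ->
  support Z = [set e; f].
Proof.
move=> CZ eZ fZ fe; have [W CW eW] := hyper_pair_e (hyper_notin CZ fZ) fe.
by rewrite -eW; apply/esym/(circuit_support_eq CW CZ); rewrite eW subUset !sub1set eZ.
Qed.

Lemma hyper_signE Z f b c : Z \in K -> f != e -> e \in side Z b ->
  f \in side Z c -> hyper_sign f = (b == c).
Proof.
move=> CZ fe eZ fZ; rewrite /hyper_sign fe /=; apply/exists_inP/eqP => [|bc].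
  case=> W CW /andP[eW fW].
  have eZW : support Z = support W.
    rewrite (hyper_e CZ (mem_side_support eZ) (mem_side_support fZ) fe).
    by rewrite (hyper_e CW _ _ fe) // inE ?eW ?fW.
  have sZW : support Z \subset support W by rewrite eZW.
  have [e1|e1] := circuits_incomparable CZ CW sZW; rewrite e1 ?side_opposite in eZ fZ.
    by rewrite (@circuit_side _ _ _ _ false _ CW eZ eW)
              (@circuit_side _ _ _ _ false _ CW fZ fW).
  apply: negb_inj.
  by rewrite (@circuit_side _ _ _ _ false _ CW eZ eW)
            (@circuit_side _ _ _ _ false _ CW fZ fW).
rewrite -bc in fZ; case: b eZ fZ {bc} => /= eZ fZ; last by exists Z; rewrite // eZ.
by exists (opposite Z); rewrite ?circuits_opposite //= eZ.
Qed.

Lemma hyper_sign_e : hyper_sign e = false.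
Proof. by rewrite /hyper_sign eqxx. Qed.

(** In this form orthogonality to the future cocircuit passes from a circuit to
    every signed set that it conforms to. *)
Definition balanced Z : Prop :=
  (exists f b, f \in side Z b /\ hyper_sign f = b) /\
  (exists f b, f \in side Z b /\ hyper_sign f = ~~ b).

Lemma balanced_opposite Z : balanced Z -> balanced (opposite Z).
Proof.
move=> [[f [b [fb sf]]] [g [c [gc sg]]]]; split.
  by exists g, (~~ c); rewrite side_opposite negbK.
by exists f, (~~ b); rewrite side_opposite !negbK.
Qed.

Lemma hyper_oriented_pair f c : f \notin H -> f != e ->
  exists Z, [/\ Z \in K, support Z = [set e; f], e \in side Z c
    & f \in side Z (hyper_sign f == c)].
Proof.
move=> fH fe; have [Z CZ eZ] := hyper_pair_e fH fe.
have /supportP[b eb] : e \in support Z by rewrite eZ !inE eqxx.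
have /supportP[d fd] : f \in support Z by rewrite eZ !inE eqxx orbT.
have ed : d = (hyper_sign f == b).
  by rewrite (hyper_signE CZ fe eb fd); case: (b) (d) => [] [].
have [bc|bc] := eqVneq b c; first by exists Z; rewrite -bc -ed.
exists (opposite Z); rewrite circuits_opposite // support_opposite !side_opposite.
have -> : (~~ (hyper_sign f == c)) = d.
  by rewrite ed; case: (hyper_sign f) (b) (c) bc => [] [] [].
by split => //; case: (b) (c) bc eb => [] [].
Qed.

(** Eliminating e between the pairs {e, f} and {e, g}, oriented oppositely at e,
    leaves the pair {f, g} with the signs of f and g inherited from them. *)
Lemma hyper_balanced_pair f g : f \notin H -> g \notin H -> f != e -> g != e ->
  f != g -> exists Z, [/\ Z \in K, support Z = [set f; g] & balanced Z].
Proof.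
move=> fH gH fe ge fg.
have [P [CP sP eP fP]] := hyper_oriented_pair false fH fe.
have [Q [CQ sQ eQ gQ]] := hyper_oriented_pair true gH ge.
have nPQ : P <> opposite Q.
  move=> ePQ; have : f \in support Q by rewrite -support_opposite -ePQ sP !inE eqxx orbT.
  by rewrite sQ !inE (negPf fe) (negPf fg).
have [W CW sW] := eliminate CP CQ nPQ eP eQ.
have sWfg : support W \subset [set f; g].
  apply/subsetP => k /supportP[c /(subsetP (sW c))].
  case/setD1P=> ke /setUP[]/mem_side_support; rewrite ?sP ?sQ !inE (negPf ke) /=.
    by move=> ->.
  by move=> ->; rewrite orbT.
have eW : support W = [set f; g].
  apply: subset_pair => //; [exact: circuit_support_neq0 CW|exact: hyper_single..].
have fW : f \in side W (hyper_sign f == false).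
  have /supportP[c fc] : f \in support W by rewrite eW !inE eqxx.
  have := subsetP (sW c) f fc; case/setD1P=> _ /setUP[fc'|/mem_side_support].
    by rewrite (circuit_side CP fP fc').
  by rewrite sQ !inE (negPf fe) (negPf fg).
have gW : g \in side W (hyper_sign g == true).
  have /supportP[c gc] : g \in support W by rewrite eW !inE eqxx orbT.
  have := subsetP (sW c) g gc; case/setD1P=> _ /setUP[/mem_side_support|gc'].
    by rewrite sP !inE (negPf ge) eq_sym (negPf fg).
  by rewrite (circuit_side CQ gQ gc').
exists W; split=> //; split.
  by exists g, (hyper_sign g == true); split=> //; rewrite eqb_id.
by exists f, (hyper_sign f == false); split=> //; rewrite eqbF_neg negbK.
Qed.

(** A circuit of the contraction through e is a pair.  Any other one contains
    two elements f and g, hence equals the pair {f, g} up to sign. *)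
Lemma hyper_balanced Z : Z \in K -> balanced Z.
Proof.
move=> CZ; have other f : f \in support Z -> exists2 g, g \in support Z & g != f.
  move=> fZ; have : support Z :\ f != set0.
    apply/eqP => e0; apply: (hyper_single CZ (f := f)).
    by rewrite -(setD1K fZ) e0 setU0.
  by case/set0Pn=> g /setD1P[]; exists g.
have [eZ|eZ] := boolP (e \in support Z).
  have [f fZ fe] := other e eZ.
  have /supportP[b eb] := eZ; have /supportP[c fc] := fZ.
  have sf := hyper_signE CZ fe eb fc.
  case: b eb sf => eb sf.
    split; first by exists f, c; rewrite sf; split=> //; case: (c).
    by exists e, true; rewrite hyper_sign_e.
  split; first by exists e, false; rewrite hyper_sign_e.
  by exists f, c; rewrite sf; split=> //; case: (c).
have /set0Pn[f fZ] := circuit_support_neq0 CZ.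
have [g gZ gf] := other f fZ.
have fe : f != e by apply: contraNneq eZ => <-.
have ge : g != e by apply: contraNneq eZ => <-.
have [|W [CW eW bW]] :=
  hyper_balanced_pair (hyper_notin CZ fZ) (hyper_notin CZ gZ) fe ge.
  by rewrite eq_sym.
have sWZ : support W \subset support Z by rewrite eW subUset !sub1set fZ.
have [eWZ|eWZ] := circuits_incomparable CW CZ sWZ; first by rewrite -eWZ.
suff -> : Z = opposite W by apply: balanced_opposite.
by rewrite eWZ; case: (Z).
Qed.

Lemma hyper_orthogonal X : X \in C -> orthogonal X hyper_cocircuit.
Proof.
move=> CX; pose Y := hyper_cocircuit.
suff h f : f \in support X -> f \notin H ->
    ((X.1 :&: Y.1) :|: (X.2 :&: Y.2) != set0) /\
    ((X.1 :&: Y.2) :|: (X.2 :&: Y.1) != set0).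
  rewrite /orthogonal; apply/eqP.
  have [/exists_inP[f fX fH]|no] := boolP [exists f in support X, f \notin H].
    by have [-> ->] := h f fX fH.
  have {no} XY b c : side X b :&: side Y c = set0.
    apply/setP => f; rewrite in_setI in_set0 side_hyper; apply/and3P => -[fX fH _].
    case/negP: no; apply/exists_inP; exists f => //; exact: mem_side_support fX.
  have := (XY false false, XY false true, XY true false, XY true true).
  by rewrite /side => -[[[-> ->] ->] ->].
move=> fX fH; have [Z [CZ fZ sZ]] := contract_circuit_refine CX fX fH.
have [[g [b [gb sg]]] [k [c [kc sk]]]] := hyper_balanced CZ.
have gY : g \in side Y b.
  by rewrite side_hyper (hyper_notin CZ (mem_side_support gb)) sg eqxx.
have kY : k \in side Y (~~ c).
  by rewrite side_hyper (hyper_notin CZ (mem_side_support kc)) sk eqxx.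
have gX := subsetP (sZ b) g gb; have kX := subsetP (sZ c) k kc.
split; apply/set0Pn; [exists g|exists k]; rewrite in_setU !in_setI.
  by case: (b) gX gY => /= -> ->; rewrite ?orbT.
by case: (c) kX kY => /= -> ->; rewrite ?orbT.
Qed.

Lemma hyper_spanned f g : f \notin H -> g \notin H -> f != g ->
  spanned N (f |: H) g.
Proof.
move=> fH gH fg.
have [Z CZ eZ] : exists2 Z, Z \in K & support Z = [set f; g].
  have [fe|fe] := eqVneq f e; first by rewrite fe in fg *; apply: hyper_pair_e; rewrite // eq_sym.
  have [ge|ge] := eqVneq g e; first by rewrite ge setUC; apply: hyper_pair_e.
  by have [Z []] := hyper_balanced_pair fH gH fe ge fg; exists Z.
have [X CX dX] := contract_circuit_lift CZ.
apply/spannedP; exists X; rewrite dX support_drop in eZ; split=> //.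
  by have /setDP[] : g \in support X :\: H by rewrite eZ !inE eqxx orbT.
by rewrite setUA setUC -subDset eZ setUC.
Qed.

(** A basis inside H would not span e.  Conversely, for f outside H, a maximal
    independent subset of f |: H that contains f is a basis, because f |: H
    spans everything; it meets the complement of H in f only. *)
Lemma hyper_matroid_cocircuit : matroid_cocircuit N (~: H).
Proof.
apply/minsetP; split.
  apply/forallP => B; apply/implyP => /maxsetP[iB maxB].
  apply: contraNneq neH => HB.
  have sBH : B \subset H by rewrite -[H]setCK -disjoints_subset -setI_eq0 setIC HB.
  have eB : e \notin B by apply: contra eH; apply: (subsetP sBH).
  apply: contraT => nH; have ieB : independent N (e |: B).
    rewrite independentU1 //; apply: contra nH; exact: spannedS.
  have := maxB _ ieB (subsetUr _ _) => eq.
  by rewrite -eq setU11 in eB.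
move=> D' /forallP meetD' sD'; apply/eqP; rewrite eqEsubset sD' /=.
apply/subsetP => f fD; apply: contraT => fD'; rewrite inE in fD.
have i1 : independent N [set f].
  apply/independentP => X CX; apply/negP => sX.
  have eX : support X = [set f].
    apply/eqP; rewrite eqEsubset sX sub1set.
    have /set0Pn[k kX] := circuit_support_neq0 CX.
    by have := subsetP sX k kX; rewrite inE => /eqP <-.
  have fX : f \in support X by rewrite eX set11.
  have [Z [CZ fZ sZ]] := contract_circuit_refine CX fX fD.
  apply: (hyper_single CZ (f := f)); apply/eqP; rewrite eqEsubset sub1set fZ andbT.
  by rewrite -eX; apply: side_sub_support.
have i1' : independent N [set f] && ([set f] \subset f |: H).
  by rewrite i1 subsetUl.
have [I] := @maxset_exists _ (fun I => independent N I && (I \subset f |: H)) _ i1'.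
move=> mI; rewrite sub1set => fI; case/maxsetP: mI => /andP[iI sI] maxI.
have spI g : g \in f |: H -> g \notin I -> spanned N I g.
  move=> gfH gI; apply: contraT => nsp.
  have : independent N (g |: I) && (g |: I \subset f |: H).
    by rewrite independentU1 // nsp subUset sub1set gfH.
  by move/maxI/(_ (subsetUr _ _)) => eq; rewrite -eq setU11 in gI.
have bI : basis N I.
  apply/maxsetP; split=> // J iJ sIJ; apply/eqP; rewrite eqEsubset sIJ andbT.
  apply/subsetP => g gJ; apply: contraT => gI.
  have : ~~ spanned N I g.
    rewrite -independentU1 //; apply/independentP => X CX.
    have := independentP iJ X CX; apply: contra => /subset_trans; apply.
    by rewrite subUset sub1set gJ.
  have [gfH|] := boolP (g \in f |: H); first by rewrite spI.
  rewrite in_setU1 negb_or => /andP[gf gH].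
  rewrite (@spanned_trans _ _ (f |: H) I g) //.
  by apply: hyper_spanned; rewrite // eq_sym.
have := meetD' I; rewrite bI => /set0Pn[k /setIP[kD' kI]].
have := subsetP sI k kI; have := subsetP sD' k kD'.
rewrite !inE => /negPf-> /orP[]// /eqP kf; by rewrite -kf kD' in fD'.
Qed.

Lemma hyper_cocircuitP : hyper_cocircuit \in cocircuits N.
Proof.
rewrite inE support_hyper hyper_matroid_cocircuit /=; apply/andP; split.
  rewrite /is_signed -setI_eq0; apply/eqP/setP => f.
  by rewrite !inE; case: (hyper_sign f); rewrite ?andbF.
by apply/forall_inP => X; apply: hyper_orthogonal.
Qed.

End Cocircuit.

(** The painting lemma for a single element with a prescribed sign. *)
Lemma cocircuit_exists (E : finType) (N : oriented_matroid E) (e : E) (G : {set E}) :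
  e \notin G -> ~~ spanned N G e ->
  exists Y, [/\ Y \in cocircuits N, e \in support Y & [disjoint support Y & G]].
Proof.
move=> eG neG.
have eG' : (e \notin G) && ~~ spanned N G e by rewrite eG.
have [H /maxsetP[/andP[eH neH] maxH] sGH] :=
  @maxset_exists _ (fun H => (e \notin H) && ~~ spanned N H e) _ eG'.
have maxH' f : f \notin H -> f != e -> spanned N (f |: H) e.
  move=> fH fe; apply: contraT => nsp.
  have : (e \notin f |: H) && ~~ spanned N (f |: H) e.
    by rewrite in_setU1 negb_or eq_sym fe eH nsp.
  by move/maxH/(_ (subsetUr _ _)) => eq; rewrite -eq setU11 in fH.
exists (hyper_cocircuit N e H); split; first exact: hyper_cocircuitP.
  by rewrite support_hyper inE.
rewrite support_hyper disjoint_sym disjoints_subset setCK //.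
Qed.

(** * Dual pairs and the painting lemma *)

Section DualPairs.
Variable E : finType.
Implicit Types (X Y : signed_set E) (A G R : {set E}) (C D : {set signed_set E}).

Lemma orthogonal_sym X Y : orthogonal X Y = orthogonal Y X.
Proof.
rewrite /orthogonal (setIC Y.1) (setIC Y.2) (setIC Y.1 X.2) (setIC Y.2 X.1).
by rewrite (setUC (X.2 :&: Y.1)).
Qed.

Lemma orthogonal_opposite X Y : orthogonal X (opposite Y) = orthogonal X Y.
Proof. by rewrite /orthogonal /= eq_sym. Qed.

(** The elements at which X becomes positive after reorientation on A. *)
Definition agrees A X : {set E} := [set e | e \in side X (e \in A)].

(** Read in the minor that contracts G and deletes R, after reorientation on A,
    such an X is a positive vector. *)
Definition fits C A G R X : bool :=
  [&& X \in C, [disjoint support X & R] & support X \subset G :|: agrees A X].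

Lemma fitsP C A G R X : reflect
  [/\ X \in C, forall f, f \in support X -> f \notin R &
      forall f, f \in support X -> f \notin G -> f \in side X (f \in A)]
  (fits C A G R X).
Proof.
apply: (iffP and3P) => -[CX dX sX]; split=> //.
- by move=> f fX; rewrite (disjointFr dX fX).
- by move=> f fX fG; have := subsetP sX f fX; rewrite inE (negPf fG) inE.
- rewrite disjoint_subset; apply/subsetP => f fX; rewrite inE; exact: dX.
- apply/subsetP => f fX; rewrite inE; have [//|fG] := boolP (f \in G).
  by rewrite inE sX.
Qed.

(** These properties are invariant under the exchange of C and D, which gives
    every consequence for circuits its dual for cocircuits. *)
Record dual_pair C D : Prop := DualPair {
  dual_signedl : forall X, X \in C -> is_signed X;
  dual_signedr : forall Y, Y \in D -> is_signed Y;
  dual_oppositel : forall X, X \in C -> opposite X \in C;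
  dual_oppositer : forall Y, Y \in D -> opposite Y \in D;
  dual_orthogonal : forall X Y, X \in C -> Y \in D -> orthogonal X Y;
  dual_painting : forall A G R e, e \notin G -> e \notin R -> [disjoint G & R] ->
    (exists2 X, fits C A G R X & e \in side X (e \in A)) \/
    (exists2 Y, fits D A R G Y & e \in side Y (e \in A)) }.

Lemma dual_pair_sym C D : dual_pair C D -> dual_pair D C.
Proof.
case=> sC sD oC oD orth paint; split=> // [X Y DX CY|A G R e eG eR dGR].
  by rewrite orthogonal_sym orth.
by have [||||] := paint A R G e; rewrite 1?disjoint_sym //; [right|left].
Qed.

(** X and Y can only clash at an element outside G and R, where both have the
    sign prescribed by A. *)
Lemma fits_orthogonal A G R X Y C D e b :
  orthogonal X Y -> is_signed X -> is_signed Y -> fits C A G R X -> fits D A R G Y ->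
  e \in side X b -> e \in side Y b -> False.
Proof.
move=> o sX sY /fitsP[_ RX AX] /fitsP[_ GY AY] eX eY.
have [k /clashP[c kX kY]] := orthogonal_clash o eX eY.
have := (RX k (mem_side_support kX), GY k (mem_side_support kY)) => -[kR kG].
have := side_inj sX kX (AX k (mem_side_support kX) kG).
have := side_inj sY kY (AY k (mem_side_support kY) kR).
by case: (c) => <-.
Qed.

Lemma orient X e c : e \in support X ->
  exists X', [/\ X' = X \/ X' = opposite X, support X' = support X & e \in side X' c].
Proof.
case/supportP=> b eX; have [bc|bc] := eqVneq b c.
  by exists X; split=> //; [left|rewrite -bc].
exists (opposite X); rewrite support_opposite side_opposite; split=> //; first by right.
by case: (b) (c) bc eX => [] [].
Qed.

(** A single common element would be an agreement without a clash, or the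
    converse. *)
Lemma orthogonal_single X Y e : orthogonal X Y -> is_signed X -> is_signed Y ->
  e \in support X -> e \in support Y ->
  exists f, [/\ f != e, f \in support X & f \in support Y].
Proof.
move=> o sX sY /supportP[b eX] eY.
have [Y' [dY <- eY']] := orient b eY.
have {}o : orthogonal X Y' by case: dY => ->; rewrite ?orthogonal_opposite.
have {}sY : is_signed Y'.
  by case: dY => ->; rewrite // /is_signed disjoint_sym.
have [f /clashP[c fX fY]] := orthogonal_clash o eX eY'; exists f; split.
- apply: contraTneq fY => fe; rewrite fe in fX *; apply/negP => fY.
  have := side_inj sY fY eY'; rewrite (side_inj sX fX eX); by case: (b).
- exact: mem_side_support fX.
- exact: mem_side_support fY.
Qed.

Lemma cocircuits_opposite (N : oriented_matroid E) Y :
  Y \in cocircuits N -> opposite Y \in cocircuits N.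
Proof.
rewrite !inE support_opposite => /and3P[sY -> /forall_inP oY]; apply/and3P; split=> //.
  by rewrite /is_signed disjoint_sym.
by apply/forall_inP => X CX; rewrite orthogonal_opposite oY.
Qed.

(** Induction on the number of elements outside G and R.  Given one such f
    other than e, move it to G, then to R.  The only case not settled by
    induction is that of a circuit X in the first case and a cocircuit Y in the
    second, both with the wrong sign at f; then X and Y agree wherever they
    meet, and they meet in e, contradicting orthogonality. *)
Lemma painting (N : oriented_matroid E) A G R e :
  e \notin G -> e \notin R -> [disjoint G & R] ->
  (exists2 X, fits (circuits N) A G R X & e \in side X (e \in A)) \/
  (exists2 Y, fits (cocircuits N) A R G Y & e \in side Y (e \in A)).
Proof.
have [n] := ubnP #|~: (G :|: R)|; elim: n G R => // n IHn G R ltn eG eR dGR.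
have [/existsP[f /and3P[fe fG fR]]|no] :=
    boolP [exists f, [&& f != e, f \notin G & f \notin R]]; last first.
  have GR f : f != e -> (f \in G) || (f \in R).
    move=> fe; apply: contraNT no; rewrite negb_or => fGR; apply/existsP.
    by exists f; rewrite fe.
  have [/spannedP[X0 [CX0 eX0 sX0]]|nsp] := boolP (spanned N G e).
    have [X [dX sX eX]] := orient (e \in A) eX0.
    left; exists X => //; apply/fitsP; rewrite sX; split.
    - by case: dX => ->; rewrite ?circuits_opposite.
    - move=> f /(subsetP sX0); rewrite in_setU1 => /orP[/eqP->//|fG].
      by rewrite (disjointFr dGR fG).
    - by move=> f /(subsetP sX0); rewrite in_setU1 => /orP[/eqP->//|->].
  have [Y0 [DY0 eY0 dY0]] := cocircuit_exists eG nsp.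
  have [Y [dY sY eY]] := orient (e \in A) eY0.
  right; exists Y => //; apply/fitsP; rewrite sY; split.
  - by case: dY => ->; rewrite ?cocircuits_opposite.
  - by move=> f fY; rewrite (disjointFr dY0 fY).
  - move=> f fY fR; have [->//|/GR] := eqVneq f e.
    by rewrite (negPf fR) orbF (disjointFr dY0 fY).
have small (B : {set E}) : ~: (G :|: R) :\ f = ~: B -> #|~: B| < n.
  move=> <-; apply: leq_trans (ltn : #|_| <= n); apply: proper_card; apply: properD1.
  by rewrite !inE negb_or fG.
have [||||[X fX eX]|[Y /fitsP[DY GY AY] eY]] := IHn (f |: G) R.
- by apply: small; apply/setP => k; rewrite !inE !negb_or -andbA.
- by rewrite in_setU1 negb_or eq_sym fe.
- by [].
- by rewrite disjoints_subset subUset sub1set inE fR -disjoints_subset.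
- have [fX'|fX'] := boolP (fits (circuits N) A G R X); first by left; exists X.
  have [||||[X' /fitsP[CX' RX' AX'] eX']|[Y fY eY]] := IHn G (f |: R).
  + by apply: small; apply/setP => k; rewrite !inE !negb_or andbCA.
  + by [].
  + by rewrite in_setU1 negb_or eq_sym fe.
  + by rewrite disjoint_sym disjoints_subset subUset sub1set inE fG -disjoints_subset disjoint_sym.
  + left; exists X' => //; apply/fitsP; split=> // k /RX'.
    by rewrite in_setU1 negb_or => /andP[].
  + have [fY'|fY'] := boolP (fits (cocircuits N) A R G Y); first by right; exists Y.
    have flip C0 G0 R0 W : fits C0 A (f |: G0) R0 W -> ~~ fits C0 A G0 R0 W ->
        f \in side W (f \notin A).
      move=> /fitsP[CW RW AW] nW; apply: contraNT nW => nfW; apply/fitsP; split=> //.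
      move=> k kW kG; have [kf|kf] := eqVneq k f; last first.
        by apply: AW => //; rewrite in_setU1 negb_or kf.
      move: nfW kW; rewrite kf => nfW /supportP[c fW].
      by case: c fW nfW; case: (f \in A) => /= ->.
    have fXs := flip _ _ _ _ fX fX'; have fYs := flip _ _ _ _ fY fY'.
    move: fX fY => /fitsP[CX RX AX] /fitsP[DY GY AY].
    have [k /clashP[c kX kY]] := orthogonal_clash (cocircuit_orthogonal CX DY) eX eY.
    have kR := RX k (mem_side_support kX); have kG := GY k (mem_side_support kY).
    have [kf|kf] := eqVneq k f.
      rewrite kf in kX kY; have := side_inj (circuits_signed CX) kX fXs.
      have := side_inj (cocircuit_signed DY) kY fYs.
      by case: (c) => <-.
    have kX' : k \in side X (k \in A).
      by apply: AX; rewrite ?(mem_side_support kX) // in_setU1 negb_or kf.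
    have kY' : k \in side Y (k \in A).
      by apply: AY; rewrite ?(mem_side_support kY) // in_setU1 negb_or kf.
    have := side_inj (circuits_signed CX) kX kX'.
    have := side_inj (cocircuit_signed DY) kY kY'.
    by case: (c) => <-.
- right; exists Y => //; apply/fitsP; split=> // k /GY.
  by rewrite in_setU1 negb_or => /andP[].
Qed.

Lemma circuits_dual_pair (N : oriented_matroid E) :
  dual_pair (circuits N) (cocircuits N).
Proof.
split; [exact: circuits_signed|exact: cocircuit_signed|exact: circuits_opposite
  |exact: cocircuits_opposite|exact: cocircuit_orthogonal|exact: painting].
Qed.

(** An agreement or a clash of Y with X already occurs for one of the circuits
    of M' that make up X, which is orthogonal to Y. *)
Lemma perspective_orthogonal (M M' : oriented_matroid E) X Y :
  perspective M M' -> X \in circuits M -> Y \in cocircuits M' -> orthogonal X Y.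
Proof.
move=> persp CX DY; have [F /subsetP sF /andP[/eqP X1 /eqP X2]] := persp X CX.
have sub Z c : Z \in F -> side Z c \subset side X c.
  by move=> FZ; case: c; rewrite /= ?X1 ?X2 (bigcup_max Z).
have cover c e : e \in side X c -> exists2 Z, Z \in F & e \in side Z c.
  by case: c => /=; rewrite ?X1 ?X2 => /bigcupP[Z FZ eZ]; exists Z.
have half Y' : Y' \in cocircuits M' ->
    ((X.1 :&: Y'.1) :|: (X.2 :&: Y'.2) != set0) ->
    ((X.1 :&: Y'.2) :|: (X.2 :&: Y'.1) != set0).
  move=> DY' /set0Pn[e]; rewrite in_setU !in_setI => eXY.
  have [c eX eY] : exists2 c, e \in side X c & e \in side Y' c.
    by case/orP: eXY => /andP[]; [exists false|exists true].
  have [Z FZ eZ] := cover c e eX.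
  have [f /clashP[b fZ fY]] :=
    orthogonal_clash (cocircuit_orthogonal (sF Z FZ) DY') eZ eY.
  have fX := subsetP (sub Z b FZ) f fZ; apply/set0Pn; exists f.
  by rewrite in_setU !in_setI; case: (b) fX fY => /= -> ->; rewrite ?orbT.
rewrite /orthogonal; apply/eqP; apply/idP/idP; first exact: half.
exact: half (cocircuits_opposite DY).
Qed.

End DualPairs.

(** * Activities of minors *)

Section MinorActivities.
Variables (d : Order.disp_t) (E : finOrderType d).
Implicit Types (X Y : signed_set E) (A G R : {set E}) (C D : {set signed_set E}).
Import Order.TTheory.

(** For the circuits C of N, this is the set of smallest elements of positive
    circuits in the minor of the reorientation of N on A where G is contracted
    and R deleted.  The trace of X on the minor need not be a circuit, but it is
    a conformal union of circuits, one of which contains e. *)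
Definition active C G R A : {set E} :=
  [set e | [&& e \notin G, e \notin R & [exists X, [&& fits C A G R X,
     e \in side X (e \in A) & [forall f in support X, (f \notin G) ==> (e <= f)%O]]]]].

Lemma activeP C G R A e : reflect
  [/\ e \notin G, e \notin R & exists X, [/\ fits C A G R X,
     e \in side X (e \in A) &
     forall f, f \in support X -> f \notin G -> (e <= f)%O]]
  (e \in active C G R A).
Proof.
rewrite inE; apply: (iffP and3P) => -[eG eR].
  case/existsP=> X /and3P[fX eX /forall_inP minX]; split=> //; exists X; split=> //.
  by move=> f /minX/implyP; apply.
case=> X [fX eX minX]; split=> //; apply/existsP; exists X; rewrite fX eX /=.
by apply/forall_inP => f fX'; apply/implyP; apply: minX.
Qed.

Lemma fits_congr C G R A A' X : (forall f, f \notin G -> f \notin R ->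
  (f \in A) = (f \in A')) -> fits C A G R X -> fits C A' G R X.
Proof.
move=> eA /fitsP[CX RX AX]; apply/fitsP; split=> // f fX fG.
by rewrite -eA ?AX ?RX.
Qed.

Lemma active_congr C G R A A' : (forall f, f \notin G -> f \notin R ->
  (f \in A) = (f \in A')) -> active C G R A = active C G R A'.
Proof.
move=> eA; suff h A1 A2 : (forall f, f \notin G -> f \notin R ->
    (f \in A1) = (f \in A2)) -> active C G R A1 \subset active C G R A2.
  apply/eqP; rewrite eqEsubset !h // => f fG fR; first by rewrite eA.
move=> {}eA; apply/subsetP => e /activeP[eG eR [X [fX eX minX]]].
apply/activeP; split=> //; exists X; split=> //; first exact: fits_congr fX.
by rewrite -eA.
Qed.

Section Last.
Variables (w : E) (G R : {set E}).
Hypotheses (wG : w \notin G) (wR : w \notin R) (dGR : [disjoint G & R]).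
Hypothesis last : forall f, f \notin G -> f \notin R -> (f <= w)%O.

(** A symmetric form of the passage from A to w |: A. *)
Definition toggle A A' := forall f, (f \in A) = (f == w) (+) (f \in A').

Lemma toggle_sym A A' : toggle A A' -> toggle A' A.
Proof. by move=> t f; rewrite t addbA addbb addFb. Qed.

Lemma toggleE A A' f : toggle A A' -> f != w -> (f \in A) = (f \in A').
Proof. by move=> t fw; rewrite t (negPf fw). Qed.

Lemma fits_delete C A X : fits C A G (w |: R) X = fits C A G R X && (w \notin support X).
Proof.
apply/fitsP/andP => [[CX RX AX]|[/fitsP[CX RX AX] wX]].
  split; last by apply/negP => /RX; rewrite setU11.
  by apply/fitsP; split=> // f /RX; rewrite in_setU1 negb_or => /andP[].
split=> // f fX; rewrite in_setU1 negb_or RX // andbT.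
by apply: contraNneq wX => <-.
Qed.

Lemma active_delete_sub C A : active C G (w |: R) A \subset active C G R A :\ w.
Proof.
apply/subsetP => e /activeP[eG eR [X [fX eX minX]]].
move: eR; rewrite in_setU1 negb_or => /andP[ew eR]; apply/setD1P; split=> //.
apply/activeP; split=> //; exists X; split=> //.
by move: fX; rewrite fits_delete => /andP[].
Qed.

Lemma active_delete_of C A e X : e \notin G -> e \notin R -> fits C A G R X ->
  e \in side X (e \in A) -> (forall f, f \in support X -> f \notin G -> (e <= f)%O) ->
  w \notin support X -> e \in active C G (w |: R) A.
Proof.
move=> eG eR fX eX minX wX; apply/activeP; split=> //; last first.
  by exists X; rewrite fits_delete fX wX.
rewrite in_setU1 negb_or eR andbT; apply: contraNneq wX => <-.
exact: mem_side_support eX.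
Qed.

Lemma active_delete_toggle C A A' : toggle A A' ->
  active C G (w |: R) A = active C G (w |: R) A'.
Proof.
move=> t; apply: active_congr => f _; rewrite in_setU1 negb_or => /andP[fw _].
exact: toggleE t fw.
Qed.

(** Contracting w means ignoring the sign of w; as w is the largest element, the
    minimality of e is not affected. *)
Lemma active_contract C A A' : toggle A A' ->
  active C (w |: G) R A = (active C G R A :|: active C G R A') :\ w.
Proof.
move=> t; apply/setP => e; rewrite in_setD1 in_setU; apply/idP/andP.
  case/activeP; rewrite in_setU1 negb_or => /andP[ew eG] eR [X [fX eX minX]].
  split=> //; move/fitsP: fX => [CX RX AX].
  have min' f : f \in support X -> f \notin G -> (e <= f)%O.
    move=> fX fG; have [->|fw] := eqVneq f w; first exact: last.
    by apply: minX => //; rewrite in_setU1 negb_or fw.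
  have AX' f : f \in support X -> f \notin G -> f != w -> f \in side X (f \in A).
    by move=> fX fG fw; apply: AX; rewrite // in_setU1 negb_or fw.
  have [wX|wX] := boolP ((w \in support X) && (w \notin side X (w \in A))).
    case/andP: wX => /supportP[b wX] nwX; apply/orP; right.
    apply/activeP; split=> //; exists X; split=> //; last by rewrite -(toggleE t ew).
    apply/fitsP; split=> // f fX fG; have [->|fw] := eqVneq f w.
      by move: (t w) wX nwX; rewrite eqxx; case: b; case: (w \in A); case: (w \in A') => //= _ ->.
    by rewrite -(toggleE t fw) AX'.
  apply/orP; left; apply/activeP; split=> //; exists X; split=> //.
  apply/fitsP; split=> // f fX fG; have [fw|fw] := eqVneq f w; last exact: AX'.
  by move: wX; rewrite -fw fX /= negbK.
have half (B : {set E}) : (forall f, f != w -> (f \in B) = (f \in A)) -> e \in active C G R B ->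
    e != w -> e \in active C (w |: G) R A.
  move=> eB /activeP[eG eR [X [/fitsP[CX RX AX] eX minX]]] ew.
  apply/activeP; rewrite in_setU1 negb_or ew; split=> //; exists X; split=> //.
  - apply/fitsP; split=> // f fX; rewrite in_setU1 negb_or => /andP[fw fG].
    by rewrite -eB // AX.
  - by rewrite -eB.
  - by move=> f fX; rewrite in_setU1 negb_or => /andP[_]; apply: minX.
case=> ew /orP[]h; apply: half h ew => // f fw; exact/esym/toggleE.
Qed.

(** A witness that avoids w would survive the deletion of w. *)
Lemma active_lost C A e : e \in active C G R A -> e \notin active C G (w |: R) A ->
  exists X, [/\ fits C A G R X, e \in side X (e \in A), w \in side X (w \in A) &
     forall f, f \in support X -> f \notin G -> (e <= f)%O].
Proof.
case/activeP=> eG eR [X [fX eX minX]] ne; exists X; split=> //.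
case/fitsP: (fX) => CX RX AX; apply: AX => //.
by apply: contraNT ne; apply: active_delete_of fX eX minX.
Qed.

Section OnePair.
Variables C D : {set signed_set E}.
Hypothesis CD : dual_pair C D.

(** The painting deletes w, the elements of R and those smaller than e: a
    positive circuit through e would then make e active after deleting w. *)
Lemma active_painting A e : e \notin G -> e \notin R -> e != w ->
  e \notin active C G (w |: R) A ->
  exists Y, [/\ Y \in D, e \in side Y (e \in A),
    forall f, f \in support Y -> f \notin G &
    forall f, f \in support Y -> f \notin R -> f != w -> (e <= f)%O ->
      f \in side Y (f \in A)].
Proof.
move=> eG eR ew ne.
pose R' := (w |: R) :|: [set f | (f \notin G) && (f < e)%O].
have eR' : e \notin R' by rewrite !inE ltxx andbF orbF negb_or ew.
have dGR' : [disjoint G & R'].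
  rewrite disjoint_subset; apply/subsetP => f fG; rewrite !inE fG orbF negb_or.
  by rewrite (disjointFr dGR fG) andbT; apply: contraNneq wG => <-.
have [[X /fitsP[CX RX AX] eX]|[Y /fitsP[DY GY AY] eY]] :=
    dual_painting CD A eG eR' dGR'.
  have RX' f : f \in support X ->
      [/\ f != w, f \notin R & f \notin G -> (e <= f)%O].
    move/RX; rewrite !inE !negb_or => /andP[/andP[-> ->]] h; split=> // fG.
    by move: h; rewrite fG /= -leNgt.
  case/negP: ne; apply: (@active_delete_of C A e X) => //.
  - by apply/fitsP; split=> // f /RX'[].
  - by move=> f /RX'[].
  - by apply/negP => /RX'[]; rewrite eqxx.
exists Y; split=> // f fY fR fw ef; apply: AY => //.
by rewrite !inE (negPf fw) (negPf fR) ltNge ef andbF.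
Qed.

(** Let Y be the cocircuit given by [active_painting] for e.  A circuit
    witnessing e forces Y to be negative at w; a circuit witnessing f for the
    other sign of w then agrees with Y at w and, as its elements are not
    smaller than e, wherever it meets Y. *)
Lemma active_exclusive_le A A' e f : toggle A A' ->
  e \in active C G R A -> e != w -> e \notin active C G (w |: R) A ->
  f \in active C G R A' -> f \notin active C G (w |: R) A' ->
  (e <= f)%O -> False.
Proof.
move=> t ea ew nea fa nfa ef.
have [eG eR _] := activeP _ _ _ _ _ ea.
have [Y [DY eY GY AY]] := active_painting eG eR ew nea.
have [X1 [fX1 eX1 wX1 min1]] := active_lost ea nea.
have [X2 [fX2 _ wX2 min2]] := active_lost fa nfa.
have sY := dual_signedr CD DY.
have wY : w \in side Y (w \notin A).
  case/fitsP: fX1 => CX1 RX1 AX1.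
  have [k /clashP[b kX kY]] := orthogonal_clash (dual_orthogonal CD CX1 DY) eX1 eY.
  have kG := GY k (mem_side_support kY); have kR := RX1 k (mem_side_support kX).
  have bk := side_inj (dual_signedl CD CX1) kX (AX1 k (mem_side_support kX) kG).
  have [kw|kw] := eqVneq k w; first by rewrite -kw -bk.
  have := side_inj sY kY (AY k (mem_side_support kY) kR kw (min1 k (mem_side_support kX) kG)).
  by rewrite bk; case: (_ \in _).
case/fitsP: fX2 => CX2 RX2 AX2.
have wX2' : w \in side X2 (w \notin A).
  by move: wX2; rewrite (t w) eqxx negbK.
have [k /clashP[b kX kY]] := orthogonal_clash (dual_orthogonal CD CX2 DY) wX2' wY.
have kG := GY k (mem_side_support kY); have kR := RX2 k (mem_side_support kX).
have [kw|kw] := eqVneq k w.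
  rewrite kw in kX kY; have := side_inj sY kY wY.
  by rewrite (side_inj (dual_signedl CD CX2) kX wX2'); case: (_ \notin _).
have := side_inj (dual_signedl CD CX2) kX (AX2 k (mem_side_support kX) kG).
rewrite -(toggleE t kw) => bk.
have ek : (e <= k)%O := le_trans ef (min2 k (mem_side_support kX) kG).
have := side_inj sY kY (AY k (mem_side_support kY) kR kw ek).
by rewrite bk; case: (_ \in _).
Qed.

(** Reversing w can create activities, compared with the deletion of w, for one
    of its two signs only: of two lost elements, the smaller one yields a
    contradiction. *)
Lemma active_exclusive A A' : toggle A A' ->
  active C G R A :\ w = active C G (w |: R) A \/
  active C G R A' :\ w = active C G (w |: R) A'.
Proof.
move=> t; have [->|n1] := eqVneq (active C G R A :\ w) (active C G (w |: R) A); first by left.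
have [->|n2] := eqVneq (active C G R A' :\ w) (active C G (w |: R) A'); first by right.
have lost B : active C G R B :\ w != active C G (w |: R) B ->
    exists e, [/\ e \in active C G R B, e != w & e \notin active C G (w |: R) B].
  rewrite eqEsubset active_delete_sub andbT => /subsetPn[e /setD1P[ew ea] ne].
  by exists e.
have [e [ea ew ne]] := lost A n1; have [f [fa fw nf]] := lost A' n2.
have [ef|fe] := orP (le_total e f).
  by case: (active_exclusive_le t ea ew ne fa nf ef).
by case: (active_exclusive_le (toggle_sym t) fa fw nf ea ne fe).
Qed.

(** That w is a loop in the minor obtained by contracting G; applied to
    cocircuits, that w is a coloop in the minor obtained by deleting G. *)
Definition loop (C : {set signed_set E}) G w : bool :=
  [exists X in C, (w \in support X) && (support X \subset w |: G)].

Lemma mem_active_last A : (w \in active C G R A) = loop C G w.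
Proof.
apply/activeP/exists_inP => [[_ _ [X [fX wX minX]]]|[X CX /andP[wX sX]]].
  case/fitsP: fX => CX RX _; exists X => //; rewrite (mem_side_support wX) /=.
  apply/subsetP => f fX; rewrite in_setU1 orbC; apply/orP.
  have [|fG] := boolP (f \in G); [by left|right].
  by rewrite eq_le last ?RX //= minX.
split=> //; have [X' [dX eX' wX']] := orient (w \in A) wX.
exists X'; rewrite eX'; split=> //.
  apply/fitsP; rewrite eX'; split.
  - by case: dX => ->; rewrite ?(dual_oppositel CD).
  - by move=> f /(subsetP sX); rewrite in_setU1 => /orP[/eqP->//|/(disjointFr dGR)->].
  - by move=> f /(subsetP sX); rewrite in_setU1 => /orP[/eqP->//|->].
by move=> f /(subsetP sX); rewrite in_setU1 => /orP[/eqP->|->].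
Qed.

Lemma active_loop A : loop C G w -> active C G R A :\ w = active C G (w |: R) A.
Proof.
move=> /exists_inP[X0 CX0 /andP[wX0 sX0]].
apply/eqP; rewrite eqEsubset active_delete_sub andbT.
apply/subsetP => e /setD1P[ew ea]; apply: contraT => ne.
have [eG eR _] := activeP _ _ _ _ _ ea.
have [Y [DY eY GY AY]] := active_painting eG eR ew ne.
have [X [/fitsP[CX RX AX] eX wX minX]] := active_lost ea ne.
have wY : w \notin support Y.
  apply/negP => wY.
  have [f [fw fX0 fY]] := orthogonal_single (dual_orthogonal CD CX0 DY)
    (dual_signedl CD CX0) (dual_signedr CD DY) wX0 wY.
  by have := subsetP sX0 f fX0; rewrite in_setU1 (negPf fw) (negPf (GY f fY)).
have [k /clashP[b kX kY]] := orthogonal_clash (dual_orthogonal CD CX DY) eX eY.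
have kG := GY k (mem_side_support kY); have kR := RX k (mem_side_support kX).
have kw : k != w by apply: contraNneq wY => <-; exact: mem_side_support kY.
have := side_inj (dual_signedl CD CX) kX (AX k (mem_side_support kX) kG).
have := side_inj (dual_signedr CD DY) kY
  (AY k (mem_side_support kY) kR kw (minX k (mem_side_support kX) kG)).
by move=> <-; case: (b).
Qed.

End OnePair.
End Last.

(** In the application C consists of the circuits of M and D of the cocircuits
    of M'; only their mutual orthogonality links the two matroids. *)
Section TwoPairs.
Variables C C' D D' : {set signed_set E}.
Hypotheses (CC : dual_pair C C') (DD : dual_pair D' D).
Hypothesis orth : forall X Y, X \in C -> Y \in D -> orthogonal X Y.
Variables (w : E) (G R : {set E}).
Hypotheses (wG : w \notin G) (wR : w \notin R) (dGR : [disjoint G & R]).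

(** Otherwise a positive circuit and a positive cocircuit would share w. *)
Lemma active_coherent A :
  active C G R A :\ w = active C G (w |: R) A \/
  active D R G A :\ w = active D R (w |: G) A.
Proof.
have [->|n1] := eqVneq (active C G R A :\ w) (active C G (w |: R) A); first by left.
have [->|n2] := eqVneq (active D R G A :\ w) (active D R (w |: G) A); first by right.
move: n1 n2; rewrite !eqEsubset !active_delete_sub !andbT.
move=> /subsetPn[e /setD1P[ew ea] ne] /subsetPn[f /setD1P[fw fa] nf].
have [X [fX _ wX _]] := active_lost wG ea ne.
have [Y [fY _ wY _]] := active_lost wR fa nf.
case/fitsP: (fX) => CX _ _; case/fitsP: (fY) => DY _ _.
have [] := fits_orthogonal (orth CX DY) (dual_signedl CC CX)
  (dual_signedr DD DY) fX fY wX wY.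
Qed.

Lemma loop_no_coloop : loop C G w -> loop D R w -> False.
Proof.
move=> /exists_inP[X CX /andP[wX sX]] /exists_inP[Y DY /andP[wY sY]].
have [f [fw fX fY]] := orthogonal_single (orth CX DY)
  (dual_signedl CC CX) (dual_signedr DD DY) wX wY.
have := subsetP sX f fX; have := subsetP sY f fY; rewrite !in_setU1 (negPf fw) /=.
by move=> fR fG; rewrite (disjointFr dGR fG) in fR.
Qed.

Lemma active_dual_loop A : loop C G w -> active D R G A :\ w = active D R (w |: G) A.
Proof.
move=> /exists_inP[X CX /andP[wX sX]].
apply/eqP; rewrite eqEsubset active_delete_sub // andbT.
apply/subsetP => e /setD1P[ew ea]; apply: contraT => ne.
have [Y [/fitsP[DY GY AY] eY wY minY]] := active_lost wR ea ne.
have [f [fw fX fY]] := orthogonal_single (orth CX DY)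
  (dual_signedl CC CX) (dual_signedr DD DY) wX (mem_side_support wY).
by have := subsetP sX f fX; rewrite in_setU1 (negPf fw) (negPf (GY f fY)).
Qed.

End TwoPairs.
End MinorActivities.

(** * Rank *)

Section Rank.
Variables (E : finType) (N : oriented_matroid E).
Implicit Types (I J S : {set E}).

Definition spanning_independent S J : Prop :=
  [/\ independent N J, J \subset S &
      forall s, s \in S -> s \notin J -> spanned N J s].

Lemma spanning_independent_exists S : exists J, spanning_independent S J.
Proof.
have i0 : independent N set0 && (set0 \subset S).
  rewrite sub0set andbT; apply/independentP => X CX; rewrite subset0.
  exact: circuit_support_neq0 CX.
have [J mJ _] := @maxset_exists _ (fun J => independent N J && (J \subset S)) _ i0.
case/maxsetP: mJ => /andP[iJ sJ] maxJ; exists J; split=> // s sS sJ'.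
apply: contraT => nsp; have : independent N (s |: J) && (s |: J \subset S).
  by rewrite independentU1 // nsp subUset sub1set sS.
by move/maxJ/(_ (subsetUr _ _)) => eq; rewrite -eq setU11 in sJ'.
Qed.

(** Basis exchange: an element i of I outside J has a circuit X in i |: J, and X
    is not inside I; swapping i with an element j of X outside I keeps J
    spanning and independent and brings it closer to I. *)
Lemma independent_card_le S I J : independent N I -> I \subset S ->
  spanning_independent S J -> #|I| <= #|J|.
Proof.
move=> iI sI; have [n] := ubnP #|I :\: J|.
elim: n J => // n IHn J ltn [iJ sJ spJ].
have [IJ|] := boolP (I \subset J); first exact: subset_leq_card.
case/subsetPn=> i iI' iJ'.
have /spannedP[X [CX iX sX]] := spJ i (subsetP sI i iI') iJ'.
have [j jX jI] : exists2 j, j \in support X & j \notin I.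
  by apply/subsetPn; apply: (independentP iI).
have ji : j != i by apply: contraNneq jI => ->.
have jJ : j \in J by have := subsetP sX j jX; rewrite in_setU1 (negPf ji).
pose J' := i |: (J :\ j).
have iJ1 : i \notin J :\ j by rewrite in_setD1 (negPf iJ') andbF.
have jJ' : j \notin J' by rewrite !inE eqxx negb_or ji.
have spj : spanned N J' j.
  apply/spannedP; exists X; split=> //; apply: subset_trans sX _.
  by rewrite /J' setUCA setD1K.
have -> : #|J| = #|J'| by rewrite cardsU1 iJ1 (cardsD1 j J) jJ.
apply: IHn.
  apply: leq_trans (ltn : #|I :\: J| <= n); apply: proper_card; apply/properP; split.
    apply/subsetP => k /setDP[kI kJ']; apply/setDP; split=> //.
    apply: contra kJ' => kJ; rewrite !inE kJ andbT orbC.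
    by have [kj|//] := eqVneq k j; rewrite -kj kI in jI.
  by exists i; rewrite !inE ?eqxx // iI' iJ'.
split.
- rewrite independentU1 //; last first.
    apply/independentP => Y CY; apply: contra (independentP iJ Y CY) => /subset_trans.
    by apply; apply: subsetDl.
  apply/spannedP => -[W [CW iW sW]].
  have nXW : support X != support W.
    apply: contraTneq jX => ->; apply/negP => /(subsetP sW).
    by rewrite !inE eqxx (negPf ji).
  have [Z CZ sZ] := eliminate_support CX CW nXW iX iW.
  have := independentP iJ Z CZ; case/negP; apply: (subset_trans sZ).
  apply/subsetP => k /setD1P[ki /setUP[/(subsetP sX)|/(subsetP sW)]];
    by rewrite !inE (negPf ki) //= => /andP[].
- rewrite subUset sub1set (subsetP sI) //=.
  by apply: subset_trans sJ; apply: subsetDl.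
- move=> s sS sJ'.
  have [->//|sj] := eqVneq s j.
  have sJ0 : s \notin J by move: sJ'; rewrite !inE negb_or sj /= => /andP[].
  apply: (@spanned_trans _ _ J) => //; last exact: spJ.
  move=> k kJ kJ'; suff -> : k = j by [].
  by move: kJ'; rewrite !inE negb_or kJ andbT negbK => /andP[_ /eqP].
Qed.

Lemma rank_spanning S J : spanning_independent S J -> rank N S = #|J|.
Proof.
move=> spJ; apply/eqP; rewrite eqn_leq /rank; apply/andP; split.
  by apply/bigmax_leqP => I /andP[sI iI]; apply: independent_card_le spJ.
by case: spJ => iJ sJ _; apply: (@leq_bigmax_cond _ _ (fun I : {set E} => #|I|) J); rewrite sJ.
Qed.

Lemma rankU1 S e : e \notin S -> rank N (e |: S) = rank N S + ~~ spanned N S e.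
Proof.
move=> eS; have [J spJ] := spanning_independent_exists S.
rewrite (rank_spanning spJ); case: (spJ) => iJ sJ gen.
have eJ : e \notin J by apply: contra eS; apply: (subsetP sJ).
have spE : spanned N S e = spanned N J e.
  apply/idP/idP; last exact: spannedS.
  exact: spanned_trans.
rewrite spE; have [sp|nsp] := boolP (spanned N J e).
  rewrite addn0; apply: rank_spanning; split=> //.
    by apply: subset_trans sJ _; apply: subsetUr.
  by move=> s; rewrite in_setU1 => /orP[/eqP->//|]; apply: gen.
rewrite addn1 -[in RHS]add1n -[1]/(nat_of_bool true) -eJ -cardsU1; apply: rank_spanning.
split; [by rewrite independentU1|exact: setUS|].
move=> s; rewrite !in_setU1 negb_or => /orP[/eqP->|sS /andP[_ sJ']].
  by rewrite eqxx.
exact: spannedS (subsetUr _ _) (gen s sS sJ').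
Qed.

Lemma rank_mono S S' : S \subset S' -> rank N S <= rank N S'.
Proof.
move=> sS; apply/bigmax_leqP => I /andP[sI iI].
apply: (@leq_bigmax_cond _ _ (fun I : {set E} => #|I|) I); rewrite iI andbT.
exact: subset_trans sS.
Qed.

(** Guarantees that the truncated subtraction in the nullity of a minor is
    exact. *)
Lemma rank_card_le S A : rank N (A :|: S) <= rank N S + #|A|.
Proof.
have [n] := ubnP #|A|; elim: n A => // n IHn A ltn.
have [->|/set0Pn[a aA]] := eqVneq A set0; first by rewrite set0U cards0 addn0.
have cA := cardsD1 a A; rewrite aA add1n in cA.
have lt' : #|A :\ a| < n by rewrite -cA.
rewrite -{1}(setD1K aA) -setUA cA addnS.
have [aS|aS] := boolP (a \in A :\ a :|: S).
  have -> : a |: (A :\ a :|: S) = A :\ a :|: S by apply/setUidPr; rewrite sub1set.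
  exact: leqW (IHn _ lt').
rewrite rankU1 // -addn1; apply: leq_add (IHn _ lt') (leq_b1 _).
Qed.

End Rank.

(** * The recursion on the largest element *)

Lemma big_subset_split (E : finType) (K : nmodType) (S : {set E}) (w : E)
    (f : {set E} -> K) : w \in S ->
  (\sum_(A : {set E} | A \subset S) f A =
   \sum_(A : {set E} | A \subset S :\ w) (f A + f (w |: A)))%R.
Proof.
move=> wS; rewrite big_split /= (bigID (fun A : {set E} => w \in A)) /= GRing.addrC.
congr (_ + _)%R; first by apply: eq_bigl => A; rewrite subsetD1.
rewrite (reindex_onto (fun A : {set E} => w |: A) (fun A => A :\ w)) /=; last first.
  by move=> A /andP[_ wA]; rewrite setD1K.
apply: eq_bigl => A; rewrite subUset sub1set wS setU11 andbT subsetD1 /=.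
congr (_ && _); apply/eqP/idP => [<-|wA]; first by rewrite setD11.
by rewrite setU1K.
Qed.

Section Recursion.
Variables (d : Order.disp_t) (E : finOrderType d).
Implicit Types (A G R S T : {set E}).
Import Order.TTheory GRing.Theory.
Local Open Scope ring_scope.

(** The combinatorial core of the recursion, where T1, U1 belong to one sign of
    the largest element and T2, U2 to the other, T0 is the deletion for
    circuits and U0 the contraction for cocircuits. *)
Lemma two_leaves (T0 T1 T2 U0 U1 U2 : {set E}) :
  T0 \subset T1 -> T0 \subset T2 -> U0 \subset U1 -> U0 \subset U2 ->
  T1 = T0 \/ T2 = T0 -> U1 = U0 \/ U2 = U0 ->
  T1 = T0 \/ U1 = U0 -> T2 = T0 \/ U2 = U0 ->
  [/\ T1 = T0, T2 = T1 :|: T2, U1 = U1 :|: U2 & U2 = U0] \/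
  [/\ T1 = T1 :|: T2, T2 = T0, U1 = U0 & U2 = U1 :|: U2].
Proof.
move=> s1 s2 s3 s4 hT hU h1 h2.
have r1 : T1 = T0 -> T2 = T1 :|: T2 by move->; apply/esym/setUidPr.
have r2 : T2 = T0 -> T1 = T1 :|: T2 by move->; apply/esym/setUidPl.
have r3 : U2 = U0 -> U1 = U1 :|: U2 by move->; apply/esym/setUidPl.
have r4 : U1 = U0 -> U2 = U1 :|: U2 by move->; apply/esym/setUidPr.
have [e1|n1] := eqVneq T1 T0; have [e2|n2] := eqVneq U2 U0.
- by left; split; auto.
- have e3 : U1 = U0 by case: hU => // e; rewrite e eqxx in n2.
  have e4 : T2 = T0 by case: h2 => // e; rewrite e eqxx in n2.
  by right; split; auto.
- have e3 : T2 = T0 by case: hT => // e; rewrite e eqxx in n1.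
  have e4 : U1 = U0 by case: h1 => // e; rewrite e eqxx in n1.
  by right; split; auto.
- have e3 : T2 = T0 by case: hT => // e; rewrite e eqxx in n1.
  have e4 : U1 = U0 by case: h1 => // e; rewrite e eqxx in n1.
  by right; split; auto.
Qed.

Section Weights.
Variable K : comNzRingType.

Definition weight T (a b : K) A : K := \prod_(e in T) (if e \in A then b else a).

Lemma weightE T a b A : weight T a b A = a ^+ #|T :\: A| * b ^+ #|T :&: A|.
Proof.
rewrite /weight (bigID (mem A)) /= mulrC; congr (_ * _).
  rewrite -prodr_const; apply: eq_big => [e|e /andP[_ /negPf->//]].
  by rewrite !inE andbC.
rewrite -prodr_const; apply: eq_big => [e|e /andP[_ ->//]].
by rewrite !inE.
Qed.

Lemma weight_toggle w T a b A : w \notin T -> weight T a b (w |: A) = weight T a b A.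
Proof.
move=> wT; apply: eq_bigr => e eT; rewrite in_setU1.
by have [ew|//] := eqVneq e w; rewrite -ew eT in wT.
Qed.

Lemma weightD1 w T a b A : weight T a b A =
  (if w \in T then if w \in A then b else a else 1) * weight (T :\ w) a b A.
Proof.
have [wT|wT] := boolP (w \in T).
  rewrite /weight (big_setD1 w) //.
by rewrite mul1r; congr weight; apply/esym/setDidPl; rewrite disjoint_sym disjoints1.
Qed.

Variables (M M' : oriented_matroid E) (persp : perspective M M').
Variables (x u y v : K).
Local Notation C := (circuits M).
Local Notation D := (cocircuits M').

(** The two summands of the identity, for the minor obtained by contracting G
    and deleting R. *)
Definition activity_weight G R A : K :=
  weight (active C G R A) y v A * weight (active D R G A) x u A.

Definition rank_weight G R A : K :=
  (x + u - 1) ^+ (rank M' (~: R) - rank M' (A :|: G)) *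
  (y + v - 1) ^+ ((#|A| + rank M G) - rank M (A :|: G)).

Section Step.
Variables (w : E) (G R A : {set E}).
Hypotheses (wG : w \notin G) (wR : w \notin R) (wA : w \notin A).
Hypothesis dGR : [disjoint G & R].
Hypothesis last : forall f, f \notin G -> f \notin R -> (f <= w)%O.

(** If w is a loop of the minor of M, then w is active for both signs and all
    other activities coincide, so that y + v is a common factor; dually for a
    coloop of the minor of M'.  Otherwise [two_leaves] matches the two signs of
    w with the deletion and the contraction.  The factors x + u - 1 and
    y + v - 1 are those that the rank generating function produces. *)
Lemma activity_weight_step :
  activity_weight G R A + activity_weight G R (w |: A) =
  (x + u - 1) ^+ loop D R w * activity_weight G (w |: R) A +
  (y + v - 1) ^+ loop C G w * activity_weight (w |: G) R A.
Proof.
have t : toggle w A (w |: A).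
  move=> f; rewrite in_setU1; have [->|//] := eqVneq f w; exact: negbTE.
have dRG : [disjoint R & G] by rewrite disjoint_sym.
have last' f : f \notin R -> f \notin G -> (f <= w)%O by move=> fR fG; apply: last.
have CC := circuits_dual_pair M.
have DD := circuits_dual_pair M'; have DD' := dual_pair_sym DD.
have o X Y : X \in C -> Y \in D -> orthogonal X Y by apply: perspective_orthogonal.
have o' Y X : Y \in D -> X \in C -> orthogonal Y X.
  by move=> DY CX; rewrite orthogonal_sym o.
rewrite /activity_weight.
rewrite (active_contract last C t) (active_contract last' D t).
rewrite (weightD1 w (active C G R A)) (weightD1 w (active D R G A)).
rewrite (weightD1 w (active C G R (w |: A))) (weightD1 w (active D R G (w |: A))).
rewrite !(mem_active_last wG wR dGR last CC) !(mem_active_last wR wG dRG last' DD').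
rewrite (negPf wA) setU11 !(weight_toggle (w := w)) ?setD11 //.
have s1 := active_delete_sub w G R C A.
have s2 := active_delete_sub w G R C (w |: A).
have s3 := active_delete_sub w R G D A.
have s4 := active_delete_sub w R G D (w |: A).
have eT := active_delete_toggle G R C t; have eU := active_delete_toggle R G D t.
rewrite -eT in s2; rewrite -eU in s4.
rewrite !setDUl.
have [lp|nlp] := boolP (loop C G w).
  rewrite (negPf (_ : ~~ loop D R w)); last first.
    by apply/negP; apply: (loop_no_coloop CC DD o dGR lp).
  rewrite !(active_loop wG dGR CC) // -eT setUid.
  rewrite !(active_dual_loop CC DD o wR) // -eU setUid.
  by ring.
have [cl|ncl] := boolP (loop D R w).
  rewrite !(active_loop wR dRG DD') // -eU setUid.
  rewrite !(active_dual_loop DD' (dual_pair_sym CC) o' wG) // -eT setUid.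
  by ring.
have := two_leaves s1 s2 s3 s4; rewrite {2}eT {2}eU.
move=> /(_ (active_exclusive wG dGR CC t)).
move=> /(_ (active_exclusive wR dRG DD' t)).
move=> /(_ (active_coherent CC DD o wG wR A)).
rewrite eT eU => /(_ (active_coherent CC DD o wG wR (w |: A))).
rewrite -eT -eU !expr0 !mul1r.
by case=> -[e1 e2 e3 e4]; rewrite -?e2 -?e3 -?e1 -?e4; ring.
Qed.

(** With [rankU1], this says that the rank of the minor of M' drops on deleting
    w exactly when w is a coloop. *)
Lemma coloopE : loop D R w = ~~ spanned M' (~: (w |: R)) w.
Proof.
have wH : w \notin ~: (w |: R) by rewrite inE setU11.
apply/exists_inP/idP => [[Y DY /andP[wY sY]]|nsp].
  apply/spannedP => -[X [CX wX sX]].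
  have [f [fw fX fY]] := orthogonal_single (cocircuit_orthogonal CX DY)
    (circuits_signed CX) (cocircuit_signed DY) wX wY.
  have := subsetP sX f fX; have := subsetP sY f fY.
  by rewrite !inE (negPf fw) /= => ->.
have [Y [DY wY dY]] := cocircuit_exists wH nsp; exists Y; rewrite // wY /=.
by move: dY; rewrite disjoints_subset setCK.
Qed.

Hypothesis sA : A \subset ~: (G :|: R).

Lemma rank_weight_delete :
  rank_weight G R A = (x + u - 1) ^+ loop D R w * rank_weight G (w |: R) A.
Proof.
rewrite /rank_weight mulrA -exprD; congr (_ ^+ _ * _).
have -> : ~: R = w |: ~: (w |: R).
  apply/setP => f; rewrite !inE negb_or.
  by have [->|] := eqVneq f w; rewrite ?wR.
rewrite rankU1; last by rewrite inE setU11.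
rewrite coloopE addnC addnBA //.
apply: rank_mono; apply/subsetP => f; rewrite !inE negb_or.
case/orP=> [fA|fG].
  have := subsetP sA f fA; rewrite !inE negb_or => /andP[_ ->]; rewrite andbT.
  by apply: contraNneq wA => <-.
by rewrite (disjointFr dGR fG) andbT; apply: contraNneq wG => <-.
Qed.

Lemma rank_weight_contract :
  rank_weight G R (w |: A) = (y + v - 1) ^+ loop C G w * rank_weight (w |: G) R A.
Proof.
rewrite /rank_weight mulrCA -exprD -setUA setUCA; congr (_ * _ ^+ _).
have le := rank_card_le M (w |: G) A; rewrite rankU1 // in le *.
rewrite cardsU1 wA addnBA; last by rewrite addnC.
congr (_ - _)%N; rewrite -[spanned M G w]/(loop C G w).
by case: (loop C G w); rewrite /= ?addn0 ?add0n ?add1n ?addn1 ?addnS ?addSn.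
Qed.

End Step.

Theorem activity_expansion G R : [disjoint G & R] ->
  \sum_(A : {set E} | A \subset ~: (G :|: R)) rank_weight G R A =
  \sum_(A : {set E} | A \subset ~: (G :|: R)) activity_weight G R A.
Proof.
have [n] := ubnP #|~: (G :|: R)|; elim: n G R => // n IHn G R ltn dGR.
have [S0|/set0Pn[w0 w0S]] := eqVneq (~: (G :|: R)) set0.
  have pr (A : {set E}) : (A \subset ~: (G :|: R)) = (A == set0).
    by rewrite S0 subset0.
  have act0 C' G' R' A : G' :|: R' = G :|: R -> active C' G' R' A = set0.
    move=> e; apply/setP => f; rewrite in_set0; apply/negP => /activeP[fG fR _].
    have : f \in ~: (G :|: R) by rewrite -e !inE negb_or fG.
    by rewrite S0 inE.
  rewrite !(eq_bigl _ _ pr) !big_pred1_eq /activity_weight !act0 1?setUC //.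
  rewrite /weight !big_set0 mulr1 /rank_weight set0U cards0 add0n.
  have -> : ~: R = G.
    apply/setP => f; rewrite inE; apply/idP/idP => [fR|/(disjointFr dGR)->//].
    apply: contraT => fG; have : f \in ~: (G :|: R) by rewrite !inE negb_or fG.
    by rewrite S0 inE.
  by rewrite !subnn !expr0 mulr1.
have [w wS maxw] : exists2 w, w \in ~: (G :|: R) &
    forall f, f \in ~: (G :|: R) -> (f <= w)%O.
  by case: (arg_maxP id w0S) => w wS maxw; exists w.
move: (wS); rewrite !inE negb_or => /andP[wG wR].
have last f : f \notin G -> f \notin R -> (f <= w)%O.
  by move=> fG fR; apply: maxw; rewrite !inE negb_or fG.
have eD : ~: (G :|: (w |: R)) = ~: (G :|: R) :\ w.
  by apply/setP => f; rewrite !inE !negb_or andbCA.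
have eC : ~: ((w |: G) :|: R) = ~: (G :|: R) :\ w.
  by apply/setP => f; rewrite !inE !negb_or andbA.
have small : (#|~: (G :|: R) :\ w| < n)%N.
  by apply: leq_trans (ltn : (#|_| <= n)%N); apply: proper_card; apply: properD1.
have dD : [disjoint G & w |: R].
  by rewrite disjoint_sym disjoints_subset subUset sub1set inE wG
    -disjoints_subset disjoint_sym.
have dC : [disjoint w |: G & R].
  by rewrite disjoints_subset subUset sub1set inE wR -disjoints_subset.
have IHD := IHn G (w |: R); rewrite eD in IHD.
have IHC := IHn (w |: G) R; rewrite eC in IHC.
rewrite !(big_subset_split _ wS).
transitivity ((x + u - 1) ^+ loop D R w *
    (\sum_(A : {set E} | A \subset ~: (G :|: R) :\ w) rank_weight G (w |: R) A) +
  (y + v - 1) ^+ loop C G w *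
    (\sum_(A : {set E} | A \subset ~: (G :|: R) :\ w) rank_weight (w |: G) R A)).
  rewrite !mulr_sumr -big_split /=; apply: eq_bigr => A; rewrite subsetD1.
  case/andP=> sA wA.
  by rewrite (rank_weight_delete wG wR wA dGR sA) rank_weight_contract.
rewrite IHD // IHC // !mulr_sumr -big_split /=; apply: eq_bigr => A.
by rewrite subsetD1 => /andP[_ wA]; rewrite activity_weight_step.
Qed.

End Weights.
End Recursion.

(** * Activities of reorientations *)

Section Global.
Variables (d : Order.disp_t) (E : finOrderType d).
Implicit Types (N : oriented_matroid E) (A : {set E}).

Lemma min_positive_reorient (C : {set signed_set E}) A :
  (forall X, X \in C -> is_signed X) ->
  min_positive [set reorient_set A X | X in C] = active C set0 set0 A.
Proof.
move=> sC; apply/setP => e; rewrite inE; apply/exists_inP/activeP.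
  case=> _ /imsetP[X CX ->] /and3P[/eqP X2 eX /forall_inP minX].
  have posX f : f \in support X -> f \in (reorient_set A X).1.
    rewrite -(support_reorient A) => /supportP[[]//].
    by rewrite /side X2 inE.
  rewrite !in_set0; split=> //; exists X; split.
  - apply/fitsP; split=> // f fX; first by rewrite in_set0.
    by have := posX f fX; rewrite in_reorient1; case: (f \in A).
  - by move: eX; rewrite in_reorient1; case: (e \in A).
  - by move=> f /posX/minX.
case=> _ _ [X [/fitsP[CX _ AX] eX minX]].
exists (reorient_set A X); first exact: imset_f.
apply/and3P; split.
- apply/eqP/setP => f; rewrite in_set0; apply/negP.
  rewrite -[_.2]/(side _ true) side_reorient => fX.
  have := AX f (mem_side_support fX); rewrite in_set0 => /(_ isT).
  by move/(side_inj (sC X CX) fX); case: (f \in A).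
- by rewrite -[_.1]/(side _ false) side_reorient.
- apply/forall_inP => f; rewrite -[_.1]/(side _ false) side_reorient => fX.
  by apply: minX; rewrite ?in_set0 // (mem_side_support fX).
Qed.

Lemma orthogonal_reorient A (X Y : signed_set E) :
  orthogonal (reorient_set A X) (reorient_set A Y) = orthogonal X Y.
Proof.
rewrite /orthogonal; congr (_ == _); congr (_ != _); apply/setP => e;
  rewrite !in_setU !in_setI !in_reorient1 !in_reorient2;
  by case: (e \in A); rewrite // orbC.
Qed.

Lemma matroid_cocircuit_reorient N A :
  matroid_cocircuit (reorient A N) =1 matroid_cocircuit N.
Proof.
have ind : independent (reorient A N) =1 independent N.
  move=> I; apply/forall_inP/forall_inP => h X CX.
    rewrite -(support_reorient A); apply: h.
    by rewrite mem_reorient_circuits reorient_setK.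
  by rewrite -(support_reorient A); apply: h; rewrite -mem_reorient_circuits.
move=> S; apply: minset_eq => S'; apply: eq_forallb => B.
by rewrite /basis (maxset_eq _ ind).
Qed.

Lemma cocircuits_reorient N A :
  cocircuits (reorient A N) = [set reorient_set A Y | Y in cocircuits N].
Proof.
apply/setP => Y; rewrite -{2}(reorient_setK A Y) mem_imset; last first.
  exact/inv_inj/reorient_setK.
rewrite !inE support_reorient matroid_cocircuit_reorient; congr (_ && (_ && _)).
  apply/idP/idP => [|/(is_signed_reorient A)]; last by rewrite reorient_setK.
  exact: is_signed_reorient.
apply/forall_inP/forall_inP => h X CX.
  rewrite -(orthogonal_reorient A) reorient_setK; apply: h.
  by rewrite mem_reorient_circuits reorient_setK.
by rewrite -(orthogonal_reorient A); apply: h; rewrite -mem_reorient_circuits.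
Qed.

Lemma O_active N A : O_ (reorient A N) = active (circuits N) set0 set0 A.
Proof. exact/min_positive_reorient/circuits_signed. Qed.

Lemma Ostar_active N A :
  Ostar (reorient A N) = active (cocircuits N) set0 set0 A.
Proof.
by rewrite /Ostar cocircuits_reorient min_positive_reorient //;
  apply: cocircuit_signed.
Qed.

Import GRing.Theory.
Local Open Scope ring_scope.

(** The theorem for all p and q at once, in the form of a Taylor expansion at
    the point x, y with increments u and v. *)
Theorem orientation_expansion (K : comNzRingType) (M M' : oriented_matroid E)
    (x u y v : K) : perspective M M' ->
  \sum_(A : {set E}) (x + u - 1) ^+ (rank M' setT - rank M' A) *
    (y + v - 1) ^+ (#|A| - rank M A) =
  \sum_(A : {set E}) (y ^+ theta M A * v ^+ theta_bar M A) *
    (x ^+ theta_star M' A * u ^+ theta_star_bar M' A).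
Proof.
move=> persp; have d0 : [disjoint (set0 : {set E}) & set0] by rewrite disjoints_subset sub0set.
have T (A : {set E}) : A \subset ~: (set0 :|: set0) by rewrite setU0 setC0 subsetT.
have := activity_expansion persp x u y v d0.
rewrite !(eq_bigl _ _ T) => e; transitivity (\sum_A rank_weight M M' x u y v set0 set0 A).
  apply: eq_bigr => A _; rewrite /rank_weight setC0 setU0.
  suff -> : rank M set0 = 0%N by rewrite addn0.
  apply/eqP; rewrite -leqn0; apply/bigmax_leqP => I /andP[].
  by rewrite subset0 => /eqP-> _; rewrite cards0.
rewrite e; apply: eq_bigr => A _; rewrite /activity_weight !weightE.
by rewrite -O_active -Ostar_active.
Qed.

End Global.

Section Coefficients.
Import GRing.Theory.
Local Open Scope ring_scope.

Lemma coef_exp_addX (R : comNzRingType) (c : R) n m :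
  ((c%:P + 'X) ^+ n)`_m = c ^+ (n - m) *+ 'C(n, m).
Proof.
rewrite exprDn coef_sum.
under eq_bigr => i _ do rewrite -polyC_exp coefMn mul_polyC coefZ coefXn.
have [mn|nm] := leqP m n; last first.
  rewrite bin_small // mulr0n big1 // => i _; rewrite gtn_eqF ?mulr0 ?mul0rn //.
  by apply: leq_trans nm; rewrite ltnS -ltnS.
rewrite (bigD1 (Ordinal (mn : (m < n.+1)%N))) //= eqxx mulr1 big1 ?addr0 // => i ni.
rewrite (_ : (m == i) = false) ?mulr0 ?mul0rn //.
by apply: contraNF ni => /eqP mi; apply/eqP/val_inj.
Qed.

End Coefficients.

Section Derivatives.
Import GRing.Theory.
Local Open Scope ring_scope.
Variables (R : comNzRingType) (n : nat).
Implicit Types (i j : 'I_n) (c : {mpoly R[n]}).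

Lemma mderiv_expXsub1 i j k :
  (('X_i - 1 : {mpoly R[n]}) ^+ k)^`M(j) =
  (k * (i == j))%:R * ('X_i - 1) ^+ k.-1.
Proof.
elim: k => [|k IHk]; first by rewrite expr0 mul0n mul0r -mpolyC1 mderivC.
have X1 : ('X_i - 1 : {mpoly R[n]})^`M(j) = (i == j)%:R.
  rewrite mderivB -[1 in LHS]mpolyC1 mderivC subr0 mderivX mnm1E.
  have [<-|ij] := eqVneq i j; last by rewrite scale0r.
  by rewrite -{1}[U_(i)%MM]add0m addmK mpolyX0 scale1r.
rewrite exprS mderivM X1 IHk /= mulSn natrD [in RHS]mulrDl; congr (_ + _).
case: k {IHk} => [|k]; first by rewrite !mul0n !mul0r mulr0.
by rewrite mulrCA -exprS.
Qed.

Lemma mderivn_expXsub1 i k m c : c^`M(i) = 0 ->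
  (('X_i - 1) ^+ k * c)^`M(i, m) = (k ^_ m)%:R * (('X_i - 1) ^+ (k - m) * c).
Proof.
move=> c0; elim: m => [|m IHm]; first by rewrite mderivn0 ffactn0 mul1r subn0.
rewrite mderivnS IHm -mpolyC_nat mderivM mderivC mul0r add0r mderivM c0.
rewrite mulr0 addr0 mderiv_expXsub1 eqxx muln1 ffactnSr natrM mpolyC_nat.
by rewrite -subnS !mulrA.
Qed.

End Derivatives.

(** * Derivatives and coefficients *)

Section Derivative.
Import GRing.Theory.
Local Open Scope ring_scope.
Variables (R : comNzRingType) (E : finType) (M M' : oriented_matroid E).

Lemma mderiv_expX n (i j : 'I_n) k : i != j ->
  (('X_i : {mpoly R[n]}) ^+ k)^`M(j) = 0.
Proof.
move=> ij; rewrite mpolyXn mderivX mulmnE mnm1E (negPf ij) mul0n.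
by rewrite scale0r.
Qed.

Lemma tutte_derivative p q (x y : R) :
  ((tutte R M M')^`M(ix, p)^`M(iy, q)).@[point3 x y 1] =
  \sum_(A : {set E})
    ((rank M' setT - rank M' A) ^_ p * (#|A| - rank M A) ^_ q)%:R *
    ((x - 1) ^+ (rank M' setT - rank M' A - p) *
     (y - 1) ^+ (#|A| - rank M A - q)).
Proof.
rewrite /tutte !raddf_sum; apply: eq_bigr => A _ /=.
set a := (_ - rank M' A)%N; set b := (_ - rank M A)%N; set c := (_ - (_ - _))%N.
rewrite -mulrA mderivn_expXsub1; last first.
  by rewrite mderivM mderiv_expXsub1 muln0 mul0r mul0r add0r mderiv_expX ?mulr0.
have swap (k f g h : {mpoly R[3]}) : k * (f * (g * h)) = g * (k * (f * h)).
  by ring.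
rewrite swap mderivn_expXsub1; last first.
  rewrite -mpolyC_nat mderivM mderivC mul0r add0r mderivM mderiv_expXsub1.
  by rewrite muln0 mul0r mul0r add0r mderiv_expX ?mulr0.
rewrite !rmorphM /= !rmorph_nat !rmorphXn !rmorphB /= !mevalXU rmorph1.
rewrite /point3 !(tnth_nth 0) /= expr1n mulr1.
by rewrite mulrA mulrACA [_%:R * _%:R]mulrC [(y - 1) ^+ _ * _]mulrC.
Qed.
End Derivative.

Section CoefficientExpansion.
Import GRing.Theory.
Local Open Scope ring_scope.

(** [orientation_expansion] over {poly {poly R}}, where u is the outer and v the
    inner indeterminate; x and y are constants. *)
Lemma coefficient_expansion (d : Order.disp_t) (E : finOrderType d)
    (M M' : oriented_matroid E) (R : comNzRingType) (x y : R) p q :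
  perspective M M' ->
  \sum_(A : {set E})
    ((x - 1) ^+ (rank M' setT - rank M' A - p) *+ 'C(rank M' setT - rank M' A, p)) *
    ((y - 1) ^+ (#|A| - rank M A - q) *+ 'C(#|A| - rank M A, q)) =
  \sum_(A : {set E} | (theta_star_bar M' A == p) && (theta_bar M A == q))
    x ^+ theta_star M' A * y ^+ theta M A.
Proof.
move=> persp.
have := orientation_expansion (K := {poly {poly R}})
  x%:P%:P 'X y%:P%:P ('X%:P) persp.
move/(congr1 (fun f : {poly {poly R}} => f`_p`_q)).
rewrite !coef_sum => e.
transitivity (\sum_(A : {set E}) (((x%:P%:P + 'X - 1) ^+ (rank M' setT - rank M' A) *
    (y%:P%:P + 'X%:P - 1) ^+ (#|A| - rank M A)) : {poly {poly R}})`_p`_q).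
  apply: eq_bigr => A _.
  have -> : x%:P%:P + 'X - 1 = (x - 1)%:P%:P + 'X :> {poly {poly R}}.
    by rewrite !polyCB addrAC.
  have -> : y%:P%:P + 'X%:P - 1 = ((y - 1)%:P + 'X)%:P :> {poly {poly R}}.
    by rewrite polyCD !polyCB addrAC.
  rewrite -polyC_exp coefMC coef_exp_addX -polyC_exp -polyCMn coefCM.
  by rewrite coef_exp_addX.
rewrite e [RHS]big_mkcond; apply: eq_bigr => A _.
rewrite -!polyC_exp mulrA -!polyCM coefCM coefXn.
rewrite mulr_natr coefMn mulrAC -polyCM coefCM coefXn.
rewrite [p == _]eq_sym [q == _]eq_sym.
by case: (_ == p); case: (_ == q); rewrite /= ?mulr1n ?mulr0n ?mulr1 ?mulr0 // mulrC.
Qed.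

End CoefficientExpansion.
Local Open Scope ring_scope.
Import GRing.Theory.

Theorem theorem4p1 (d : Order.disp_t) (E : finOrderType d)
    (M M' : oriented_matroid E) (hMM' : perspective M M')
    (p q : nat) (R : comNzRingType) (x y : R) :
  ((tutte R M M')^`M(ix, p)^`M(iy, q)).@[point3 x y 1] =
    (p`! * q`!)%:R *
    \sum_(A : {set E} | (theta_star_bar M' A == p) && (theta_bar M A == q))
      x ^+ theta_star M' A * y ^+ theta M A.
Proof.
rewrite tutte_derivative -(coefficient_expansion x y p q hMM') mulr_sumr.
apply: eq_bigr => A _.
rewrite -!bin_ffact !natrM -!(mulr_natr (_ ^+ _)).
have regroup (b f c g X Y : R) : b * f * (c * g) * (X * Y) =
    f * g * (X * b * (Y * c)) by ring.
exact: regroup.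
Qed.
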